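(* Let $(M,g)$ be a closed Riemannian manifold and let $\mathcal{F}=\{g_j+ih_j\mid j\in\{1,\dots,n\}\}$ be a $(\lambda,\mu)$-eigenfamily on $M$, where $g_j,h_j:M\to\mathbb{R}$. Let $a_1,\dots,a_n,b_1,\dots,b_n\in\mathbb{N}$. Then $$\int_M g_1^{a_1}h_1^{b_1}\cdots g_n^{a_n}h_n^{b_n}\,dV_g=(-1)^{\sum_j b_j}\int_M g_1^{b_1}h_1^{a_1}\cdots g_n^{b_n}h_n^{a_n}\,dV_g.$$
   Context: Closed means compact without boundary; $\mathbb{N}=\{0,1,2,\dots\}$; $dV_g$ is the Riemannian volume form of $(M,g)$. $\Delta=\operatorname{div}\nabla$ is the Laplace-Beltrami operator, extended complex-linearly; the metric $g$ is extended complex-bilinearly to $T^{\mathbb{C}}M$ and $\kappa(\varphi,\psi)=g(\nabla\varphi,\nabla\psi)$. For $\lambda,\mu\in\mathbb{C}$, a set $\mathcal{F}$ of smooth functions $M\to\mathbb{C}$ is a $(\lambda,\mu)$-eigenfamily if $\Delta\varphi=\lambda\varphi$ and $\kappa(\varphi,\psi)=\mu\varphi\psi$ for all (not necessarily distinct) $\varphi,\psi\in\mathcal{F}$.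
   Formalization: The formal theorem additionally assumes that λ and μ are not both zero; without this the claim fails, e.g. for the (0,0)-eigenfamily {1} with a_1=1, b_1=0, where the left side is Vol(M) and the right side is 0. *)

(* Defs.v *)
From HB Require Import structures.
From mathcomp Require Import all_boot all_order all_algebra.
From mathcomp Require Import all_classical all_reals all_analysis.
From mathcomp Require Import complex.

Set Implicit Arguments.
Unset Strict Implicit.
Unset Printing Implicit Defensive.

Import Order.TTheory GRing.Theory Num.Theory.
Import numFieldNormedType.Exports.

Local Open Scope classical_set_scope.
Local Open Scope ring_scope.
Local Open Scope complex_scope.

Section lebesgue_tuple.
Context {R : realType}.

Definition tuple_cons m (p : R * m.-tuple R) : m.+1.-tuple R :=
  [tuple of p.1 :: p.2].

Lemma measurable_tuple_cons m :
  measurable_fun [set: R * m.-tuple R] (@tuple_cons m).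
Proof. exact: measurable_cons. Qed.

Section step.
Variables (m : nat)
  (nu : {sigma_finite_measure set (m.-tuple R) -> \bar R}).

Definition lebesgue_step : set (m.+1.-tuple R) -> \bar R :=
  pushforward (@lebesgue_measure R \x nu)%E (@tuple_cons m).

Let measurable_preimage A : measurable A -> measurable (@tuple_cons m @^-1` A).
Proof.
by move=> mA; rewrite -[X in measurable X]setTI; exact: measurable_tuple_cons.
Qed.

Let lebesgue_step0 : lebesgue_step set0 = 0%E.
Proof. by rewrite /lebesgue_step /pushforward preimage_set0 measure0. Qed.

Let lebesgue_step_ge0 A : (0 <= lebesgue_step A)%E.
Proof. by rewrite /lebesgue_step /pushforward. Qed.

Let lebesgue_step_sigma_additive : semi_sigma_additive lebesgue_step.
Proof.
move=> F mF tF mUF; rewrite /lebesgue_step /pushforward preimage_bigcup.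
apply: measure_semi_sigma_additive.
- by move=> n; exact: measurable_preimage.
- by apply/trivIsetP => i j _ _ ij; rewrite -preimage_setI;
    move/trivIsetP : tF => /(_ _ _ _ _ ij) ->//; rewrite preimage_set0.
- by rewrite -preimage_bigcup; exact: measurable_preimage.
Qed.

HB.instance Definition _ := isMeasure.Build _ _ _ lebesgue_step
  lebesgue_step0 lebesgue_step_ge0 lebesgue_step_sigma_additive.

Let lebesgue_step_sigma_finite : sigma_finite setT lebesgue_step.
Proof.
have /sigma_finiteP[F [TF ndF Foo]] := sigma_finiteT (@lebesgue_measure R).
have /sigma_finiteP[G [TG ndG Goo]] := sigma_finiteT nu.
pose uncons (t : m.+1.-tuple R) : R * m.-tuple R :=
  (thead t, [tuple of behead t]).
have consK : cancel (@tuple_cons m) uncons.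
  by case=> x t; rewrite /uncons /tuple_cons theadE; congr pair; apply/val_inj.
have muncons : measurable_fun [set: m.+1.-tuple R] uncons.
  by apply/measurable_fun_pair;
    [exact: measurable_tnth|exact: measurable_behead].
exists (fun k => uncons @^-1` (F k `*` G k)).
  rewrite predeqE => t; split=> // _.
  have : (\bigcup_k F k) (uncons t).1 by rewrite -TF.
  have : (\bigcup_k G k) (uncons t).2 by rewrite -TG.
  move=> [k _ Gk] [l _ Fl]; exists (maxn k l) => //; split.
  - by move: Fl; exact/subsetPset/ndF/leq_maxr.
  - by move: Gk; exact/subsetPset/ndG/leq_maxl.
move=> k; have [mF Fk] := Foo k; have [mG Gk] := Goo k; split.
  by rewrite -[X in measurable X]setTI; apply: muncons => //; exact: measurableX.
rewrite /lebesgue_step /pushforward.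
rewrite (_ : _ @^-1` _ = F k `*` G k); last first.
  by rewrite -comp_preimage (_ : _ \o _ = id) //; apply/funext; exact: consK.
by rewrite product_measure1E// lte_mul_pinfty// ge0_fin_numE.
Qed.

HB.instance Definition _ := Measure_isSigmaFinite.Build _ _ _ lebesgue_step
  lebesgue_step_sigma_finite.

End step.

Fixpoint lebesgue_tuple m : {sigma_finite_measure set (m.-tuple R) -> \bar R} :=
  match m with
  | 0 => dirac [tuple]
  | m'.+1 => lebesgue_step (lebesgue_tuple m')
  end.

End lebesgue_tuple.

Notation borel T := (g_sigma_algebraType (@open T)).

Section calculus.
Context {R : realType} {m : nat}.
Implicit Types (V : set 'rV[R]_m) (f : 'rV[R]_m -> R).

Definition partial (i : 'I_m) f : 'rV[R]_m -> R := 'D_(delta_mx 0 i) f.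

Fixpoint Ck_on (k : nat) V f : Prop :=
  {in V, continuous f} /\
  if k is k'.+1 then
    forall i, (forall u, V u -> derivable f u (delta_mx 0 i)) /\
              Ck_on k' V (partial i f)
  else True.

(* Meant for open V only. *)
Definition smooth_on V f : Prop := forall k, Ck_on k V f.

End calculus.

Section charts.
Context {R : realType} {m : nat}.

(* The values of chart_map off chart_dom, and of chart_inv off the image of
   chart_dom, carry no meaning. *)
Record chart (M : topologicalType) := Chart {
  chart_dom : set M;
  chart_map : M -> 'rV[R]_m;
  chart_inv : 'rV[R]_m -> M;
  chart_dom_open : open chart_dom;
  chart_cod_open : open (chart_map @` chart_dom);
  chart_mapK : {in chart_dom, cancel chart_map chart_inv};
  chart_map_continuous : {in chart_dom, continuous chart_map};
  chart_inv_continuous : {in chart_map @` chart_dom, continuous chart_inv}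
}.

Definition chart_cod (M : topologicalType) (c : chart M) : set 'rV[R]_m :=
  chart_map c @` chart_dom c.

Definition transition (M : topologicalType) (c d : chart M) :
  'rV[R]_m -> 'rV[R]_m := chart_map d \o chart_inv c.

End charts.

Arguments chart R m M : clear implicits.

(* The atlas need not be maximal. *)
Record smoothManifold (R : realType) (m : nat) := SmoothManifold {
  carrier :> ptopologicalType;
  manifold_hausdorff : hausdorff_space carrier;
  manifold_second_countable : @second_countable carrier;
  atlas : set (chart R m carrier);
  atlas_cover : \bigcup_(c in atlas) chart_dom c = setT;
  atlas_compatible : forall c d, atlas c -> atlas d -> forall j : 'I_m,
    smooth_on (chart_map c @` (chart_dom c `&` chart_dom d))
      (fun u => transition c d u 0 j)
}.

(* A metric is given by its coordinate matrices: gram c u has entries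
   g(d/dx_i, d/dx_j) at the point with coordinates u in the chart c.  Tangent
   vectors are row vectors, so the Jacobian 'J F u acts on them from the right. *)
Record riemannianMetric (R : realType) (m : nat) (X : smoothManifold R m) :=
  RiemannianMetric {
  gram : chart R m X -> 'rV[R]_m -> 'M[R]_m;
  gram_smooth : forall c, atlas c -> forall i j,
    smooth_on (chart_cod c) (fun u => gram c u i j);
  gram_sym : forall c, atlas c -> forall u, chart_cod c u ->
    (gram c u)^T = gram c u;
  gram_posdef : forall c, atlas c -> forall u, chart_cod c u ->
    forall v : 'rV[R]_m, v != 0 -> 0 < (v *m gram c u *m v^T) 0 0;
  gram_transition : forall c d, atlas c -> atlas d ->
    forall x, chart_dom c x -> chart_dom d x ->
    let u := chart_map c x in
    let J : 'M[R]_m := 'J (transition c d) u in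
    gram c u = J *m gram d (chart_map d x) *m J^T
}.

Section riemannian.
Context {R : realType} {m : nat} {X : smoothManifold R m}.
Variable G : riemannianMetric X.

Definition smooth_fun (f : X -> R) : Prop :=
  forall c : chart R m X, atlas c -> smooth_on (chart_cod c) (f \o chart_inv c).

Definition smooth_cfun (phi : X -> R[i]) : Prop :=
  smooth_fun (fun x => complex.Re (phi x)) /\
  smooth_fun (fun x => complex.Im (phi x)).

Definition sqrt_det (c : chart R m X) (u : 'rV[R]_m) : R :=
  Num.sqrt (\det (gram G c u)).

(* Components in the chart c of the gradient of f: the vector field with
   g(grad f, v) = df(v). *)
Definition grad (c : chart R m X) (f : X -> R) (u : 'rV[R]_m) : 'rV[R]_m :=
  (\row_i partial i (f \o chart_inv c) u) *m invmx (gram G c u).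

(* Divergence of the vector field with components Y in the chart c. *)
Definition div (c : chart R m X) (Y : 'rV[R]_m -> 'rV[R]_m)
    (u : 'rV[R]_m) : R :=
  (sqrt_det c u)^-1 * \sum_i partial i (fun w => sqrt_det c w * Y w 0 i) u.

Definition laplacian (c : chart R m X) (f : X -> R) (x : X) : R :=
  div c (grad c f) (chart_map c x).

Definition claplacian (c : chart R m X) (phi : X -> R[i]) (x : X) : R[i] :=
  laplacian c (fun y => complex.Re (phi y)) x +i*
  laplacian c (fun y => complex.Im (phi y)) x.

Definition cgrad (c : chart R m X) (phi : X -> R[i]) (x : X) : 'rV[R[i]]_m :=
  \row_i (grad c (fun y => complex.Re (phi y)) (chart_map c x) 0 i +i*
          grad c (fun y => complex.Im (phi y)) (chart_map c x) 0 i).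

Definition cmetric (c : chart R m X) (x : X) (v w : 'rV[R[i]]_m) : R[i] :=
  (v *m map_mx (real_complex R) (gram G c (chart_map c x)) *m w^T) 0 0.

Definition kappa (c : chart R m X) (phi psi : X -> R[i]) (x : X) : R[i] :=
  cmetric c x (cgrad c phi x) (cgrad c psi x).

(* claplacian and kappa do not depend on the choice of the chart around x; the
   two equations are required in every chart around x. *)
Definition eigenfamily (lam mu : R[i]) (F : set (X -> R[i])) : Prop :=
  [/\ forall phi, F phi -> smooth_cfun phi,
      forall phi, F phi -> forall x (c : chart R m X),
        atlas c -> chart_dom c x -> claplacian c phi x = lam * phi x
    & forall phi psi, F phi -> F psi -> forall x (c : chart R m X),
        atlas c -> chart_dom c x -> kappa c phi psi x = mu * phi x * psi x].

(* vol is the Riemannian volume measure: it is uniquely determined by the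
   formula dV_g = sqrt (det g) dx_1 ... dx_m in every chart, as countably many
   charts cover X. *)
Definition riemannian_volume (vol : {measure set (borel X) -> \bar R}) : Prop :=
  forall c : chart R m X, atlas c ->
  forall A : set (borel X), measurable A -> A `<=` chart_dom c ->
  vol A = (\int[lebesgue_tuple m]_(t in
    [set t : m.-tuple R | (chart_map c @` A) (\row_i tnth t i)])
      (sqrt_det c (\row_i tnth t i))%:E)%E.

End riemannian.

(* Main.v *)
(* Write phi_j = g_j + i h_j.  The Laplacian maps a product of d of the phi_j to
   Lambda_d = d lam + d (d - 1) mu times itself, so Green's formula gives
   (Lambda_d - conj Lambda_e) * \int F (conj H) = 0 for products F and H of d and
   e of the phi_j.  If some phi_j is not zero, taking F = H shows that the
   Lambda_d are real; moreover lam + k mu never vanishes, as otherwise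
   phi_j ^ (k + 1) would be harmonic, hence of zero gradient, which forces
   mu = lam = 0.  So \int F (conj H) = 0 whenever d <> e, and the integral of any
   polynomial in the phi_j and their conjugates is unchanged when every phi_j is
   multiplied by a complex number of modulus 1.  The number - i turns g_j into
   h_j and h_j into - g_j.

   Only Green's formula \int (f Delta v + <grad f, grad v>) = 0 for f of class
   C^1 is needed.  A C^1 partition of unity reduces it to one chart, where it
   says that the partial derivatives of a compactly supported C^1 function have
   integral 0. *)

Require Import Defs.
From HB Require Import structures.
From mathcomp Require Import all_boot all_order all_algebra.
From mathcomp Require Import all_classical all_reals all_analysis.
From mathcomp Require Import measurable_realfun complex.
From mathcomp Require Import ring lra.

Import Order.TTheory GRing.Theory Num.Theory.
Import numFieldNormedType.Exports.

Set Implicit Arguments.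
Unset Strict Implicit.
Unset Printing Implicit Defensive.

Local Open Scope classical_set_scope.
Local Open Scope ring_scope.
Local Open Scope complex_scope.

(** * Integrating partial derivatives over R^m *)

(** The pair lam = mu = 0 has to be excluded: the constant 1 is a (0, 0)-eigenfamily, and the
    exponents a = 1, b = 0 would equate the volume of M with 0. Working with C^1 functions is what
    keeps the analysis light: they form an algebra, they contain bumps as simple as squares of
    positive parts, and second derivatives are only ever taken of the smooth functions g_j and h_j,
    because the eigenvalue equation of a product is stated weakly, against C^1 test functions. The
    invariance under multiplication by a number of modulus 1 is obtained without expanding any
    polynomial: factors are exchanged one at a time, and each partial product is tested against all
    monomials in the phi_j and their conjugates, which makes the induction go through. *)

Section euclidean_integral.
Context {R : realType}.
Local Notation mu := (@lebesgue_measure R).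

Lemma integrable_bounded_support d (T : measurableType d)
    (nu : {measure set T -> \bar R}) (D : set T) (g : T -> R) (C : R) :
    measurable D -> (nu D < +oo)%E -> measurable_fun setT g ->
    (forall t, `|g t| <= C) -> (forall t, ~ D t -> g t = 0) ->
  nu.-integrable setT (EFin \o g).
Proof.
move=> mD Dfin mg gC g0.
have -> : EFin \o g = (EFin \o g) \_ D.
  apply/funext => t; rewrite patchE; case: ifPn => //.
  by rewrite notin_setE => /g0 /= ->.
apply/(integrable_mkcond _ mD); apply: measurable_bounded_integrable => //.
  exact: measurable_funTS.
exists C; split; first exact: num_real.
by move=> M CM t _ /=; apply: le_trans (gC t) (ltW CM).
Qed.

Lemma integral_derivative_compact_support (F g : R -> R) (K : R) :
    (forall x : R, is_derive x 1 F (g x)) -> continuous g ->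
    (forall x, K <= `|x| -> F x = 0) -> (forall x, K <= `|x| -> g x = 0) ->
  (\int[mu]_x (g x)%:E = 0)%E.
Proof.
move=> dF cg F0 g0.
(* [K] may be negative or zero, whereas the fundamental theorem of calculus is applied on an
   interval [[-L, L]] with [-L < L]. *)
pose L := Num.max K 1; have L0 : 0 < L by rewrite lt_max ltr01 orbT.
have KL : K <= L by rewrite le_max lexx.
have -> : (\int[mu]_x (g x)%:E = \int[mu]_(x in `[(- L)%R, L]) (g x)%:E)%E.
  rewrite [RHS]integral_mkcond; apply: eq_integral => x _.
  rewrite patchE; case: ifPn => //; rewrite notin_setE /= in_itv/= -ler_norml.
  by move/negP; rewrite -ltNge => /ltW Lx; rewrite g0// (le_trans KL).
have cF : continuous F.
  by move=> x; apply/differentiable_continuous/derivable1_diffP; case: (dF x).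
rewrite (@continuous_FTC2 _ g F) ?gtrN//.
- rewrite F0 ?F0 ?sube0//.
    by rewrite normrN ger0_norm// ltW.
  by rewrite ger0_norm// ltW.
- exact: continuous_subspaceT.
- split.
  + by move=> x _; case: (dF x).
  + exact/cvg_at_right_filter/cF.
  + exact/cvg_at_left_filter/cF.
- by move=> x _; rewrite derive1E derive_val.
Qed.

Definition tuple_box m (K : R) : set (m.-tuple R) :=
  [set t | forall j, `|tnth t j| <= K].

Lemma tuple_consS m (x : R) (t : m.-tuple R) (j : 'I_m) :
  tnth (tuple_cons (x, t)) (lift ord0 j) = tnth t j.
Proof. by rewrite /tuple_cons tnthS. Qed.

Lemma tuple_cons_box m (K : R) :
  @tuple_cons R m @^-1` @tuple_box m.+1 K = `[- K, K] `*` @tuple_box m K.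
Proof.
apply/seteqP; split=> -[x t] /=.
  move=> H; split => /=; first by have := H ord0; rewrite in_itv/= -ler_norml.
  by move=> j; have := H (lift ord0 j); rewrite tuple_consS.
move=> [xK tK] j; case: (unliftP ord0 j) => [j'|] ->.
  by rewrite tuple_consS; exact: tK.
by move: xK; rewrite /= in_itv/= -ler_norml.
Qed.

Lemma measurable_tuple_box m (K : R) : measurable (@tuple_box m K).
Proof.
have -> : @tuple_box m K = \bigcap_(j in [set: 'I_m])
    (fun t : m.-tuple R => tnth t j) @^-1` `[- K, K].
  apply/seteqP; split=> t /= H j.
    by move=> _ /=; rewrite in_itv/= -ler_norml.
  by have := H j I; rewrite /= in_itv/= -ler_norml.
apply: fin_bigcap_measurable => // j _.
by rewrite -[X in measurable X]setTI; apply: measurable_tnth.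
Qed.

Lemma lebesgue_tuple_box_lty m (K : R) :
  (lebesgue_tuple m (@tuple_box m K) < +oo)%E.
Proof.
elim: m => [|m IH] /=.
  by rewrite /dirac /= indicE ltry.
rewrite /lebesgue_step /pushforward tuple_cons_box.
rewrite product_measure1E//; last exact: measurable_tuple_box.
apply: lte_mul_pinfty => //.
have /= := lebesgue_measure_itv `[- K, K].
by move=> /(congr1 (fun x => x \is a fin_num)) ->; case: ifP.
Qed.

Definition set_tnth m (i : 'I_m) (t : m.-tuple R) (s : R) : m.-tuple R :=
  [tuple if j == i then s else tnth t j | j < m].

Lemma set_tnth_cons0 m (x s : R) (t : m.-tuple R) :
  set_tnth ord0 (tuple_cons (x, t)) s = tuple_cons (s, t).
Proof.
apply: eq_from_tnth => j; rewrite tnth_mktuple.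
case: (unliftP ord0 j) => [j'|] ->; last by rewrite eqxx.
by rewrite eq_sym (negbTE (neq_lift _ _)) !tuple_consS.
Qed.

Lemma set_tnth_consS m (i : 'I_m) (x s : R) (t : m.-tuple R) :
  set_tnth (lift ord0 i) (tuple_cons (x, t)) s = tuple_cons (x, set_tnth i t s).
Proof.
apply: eq_from_tnth => j; rewrite tnth_mktuple.
case: (unliftP ord0 j) => [j'|] ->.
  by rewrite (inj_eq lift_inj) !tuple_consS tnth_mktuple.
by rewrite (negbTE (neq_lift _ _)).
Qed.

(** By Fubini the integration may be carried out in the favourable order. The measure is built by
    adjoining a first coordinate: if [i] is that coordinate, it is integrated first, by the
    fundamental theorem of calculus; otherwise it is frozen and the induction hypothesis applies to
    the remaining ones. The hypotheses speak of the restrictions to lines [set_tnth i t], so no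
    differential calculus on tuples is involved. *)
Lemma integral_lebesgue_tuple_derivative m (i : 'I_m)
    (F g : m.-tuple R -> R) (K C : R) :
    measurable_fun setT g -> (forall t, `|g t| <= C) ->
    (forall t j, K <= `|tnth t j| -> F t = 0) ->
    (forall t j, K <= `|tnth t j| -> g t = 0) ->
    (forall t (s : R), is_derive s 1 (F \o set_tnth i t) (g (set_tnth i t s))) ->
    (forall t, continuous (g \o set_tnth i t)) ->
  (\int[lebesgue_tuple m]_t (g t)%:E = 0)%E.
Proof.
elim: m i F g => [[]//|m IH] i F g mg gC F0 g0 dF cg.
have mgc : measurable_fun setT (g \o @tuple_cons R m).
  by apply: measurableT_comp => //; exact: measurable_tuple_cons.
have ig : ((@lebesgue_measure R \x lebesgue_tuple m)%E).-integrable setT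
    (EFin \o (g \o @tuple_cons R m)).
  apply: (@integrable_bounded_support _ _
    (@lebesgue_measure R \x lebesgue_tuple m)%E
    (`[- K, K] `*` @tuple_box m K) _ C).
  - by apply: measurableX => //; exact: measurable_tuple_box.
  - by have := lebesgue_tuple_box_lty m.+1 K;
      rewrite /= /lebesgue_step /pushforward tuple_cons_box.
  - exact: mgc.
  - by move=> t; exact: gC.
  - move=> t; rewrite -tuple_cons_box /= => /existsNP[j /negP].
    by rewrite -ltNge => /ltW; exact: g0.
transitivity (\int[pushforward (@lebesgue_measure R \x lebesgue_tuple m)
    (@tuple_cons R m)]_(t in setT) (g t)%:E)%E; first by [].
rewrite integral_pushforward //=.
- rewrite preimage_setT; case: (unliftP ord0 i) => [i'|] ii.
  + rewrite -integral12_prod_meas1//; rewrite /fubini_F.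
    rewrite (eq_integral (cst 0%E)) ?integral0// => x _ /=.
    apply: (IH i' (fun t => F (tuple_cons (x, t))) (fun t => g (tuple_cons (x, t)))).
    * apply: measurableT_comp => //.
      by apply: (measurable_cons (f := cst x) (g := id)).
    * by move=> t; exact: gC.
    * by move=> t j tj; apply: (F0 _ (lift ord0 j)); rewrite tuple_consS.
    * by move=> t j tj; apply: (g0 _ (lift ord0 j)); rewrite tuple_consS.
    * move=> t s; have := dF (tuple_cons (x, t)) s; rewrite ii set_tnth_consS.
      by congr is_derive; apply/funext => s' /=; rewrite set_tnth_consS.
    * move=> t; rewrite (_ : _ \o _ = g \o set_tnth i (tuple_cons (x, t))).
        exact: cg.
      by apply/funext => s /=; rewrite ii set_tnth_consS.
  + rewrite -integral21_prod_meas1//; rewrite /fubini_G.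
    rewrite (eq_integral (cst 0%E)) ?integral0// => t _ /=.
    apply: (@integral_derivative_compact_support (fun x => F (tuple_cons (x, t)))
      (fun x => g (tuple_cons (x, t))) K).
    * move=> s; have := dF (tuple_cons (0, t)) s; rewrite ii set_tnth_cons0.
      by congr is_derive; apply/funext => s' /=; rewrite set_tnth_cons0.
    * rewrite (_ : (fun _ => _) = g \o set_tnth i (tuple_cons (0, t))).
        exact: cg.
      by apply/funext => s /=; rewrite ii set_tnth_cons0.
    * by move=> s sK; apply: (F0 _ ord0).
    * by move=> s sK; apply: (g0 _ ord0).
- exact: measurable_tuple_cons.
- exact/measurable_EFinP.
Qed.

End euclidean_integral.

(** * Open sets of R^m as measurable sets of tuples *)

Section borel_tuples.
Context {R : realType} {m : nat}.

Definition row_of_tuple (t : m.-tuple R) : 'rV[R]_m := \row_i tnth t i.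
Definition tuple_of_row (u : 'rV[R]_m) : m.-tuple R := [tuple u 0 i | i < m].

(** An open set is the union of the cubes [P q] that it contains, with rational centre and radius
    [1 / (k + 1)], and there are only countably many of these. A radius below [e / 2] suffices
    around a point whose ball of radius [e] lies in [U]: the centre is within one radius of the
    point, and every point of the cube within another. *)
Lemma open_measurable_tuple (U : set 'rV[R]_m) : open U ->
  measurable (row_of_tuple @^-1` U).
Proof.
move=> oU.
pose P (q : m.-tuple rat * nat) : set 'rV[R]_m :=
  [set v | forall i, `|ratr (tnth q.1 i) - v 0 i| < q.2.+1%:R^-1].
pose F q := if `[< P q `<=` U >] then row_of_tuple @^-1` (P q) else set0.
have -> : row_of_tuple @^-1` U = \bigcup_q F q.
  apply/seteqP; split=> t /=; last first.
    by move=> [q _]; rewrite /F; case: asboolP => // PU /PU.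
  move=> Ut; have /nbhs_ballP[e /= e0 eU] := open_nbhs_nbhs (conj oU Ut).
  have [k ke] : exists k : nat, k.+1%:R^-1 < e / 2.
    have e20 : 0 < e / 2 by lra.
    have := near_infty_natSinv_lt (PosNum e20).
    by case=> N _ /(_ N (leqnn N)) /= ?; exists N.
  have k0 : 0 < k.+1%:R^-1 :> R by rewrite invr_gt0.
  set d := k.+1%:R^-1 in ke k0.
  have /choice[q qP] : forall i : 'I_m, exists q : rat,
      `|ratr q - tnth t i| < d.
    move=> i; have /rat_in_itvoo[q] :
        tnth t i - d < tnth t i + d by lra.
    rewrite in_itv/= => /andP[]; set r := ratr q => q1 q2; exists q.
    by rewrite -/r ltr_norml; apply/andP; split; lra.
  exists ([tuple q i | i < m], k) => //; rewrite /F asboolT.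
    by move=> i /=; rewrite tnth_mktuple mxE.
  move=> v Pv; apply: eU; split=> // a i; rewrite (ord1 a).
  rewrite /ball/= mxE; have := Pv i; rewrite -/d.
  have := qP i => /=; rewrite tnth_mktuple.
  rewrite !ltr_norml => /andP[? ?] /andP[? ?]; apply/andP; split; lra.
apply: countable_bigcupT_measurable => // -[q k].
rewrite /F; case: asboolP => // _.
have -> : row_of_tuple @^-1` P (q, k) = \bigcap_(j in [set: 'I_m])
    (fun t : m.-tuple R => tnth t j) @^-1`
      `](ratr (tnth q j) - k.+1%:R^-1), (ratr (tnth q j) + k.+1%:R^-1)[.
  apply/seteqP; split=> t /= H j.
    by move=> _ /=; rewrite in_itv/= -ltr_distl distrC; have := H j; rewrite mxE.
  by have := H j I; rewrite /= in_itv/= -ltr_distl distrC mxE.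
apply: fin_bigcap_measurable => // j _.
by rewrite -[X in measurable X]setTI; apply: measurable_tnth.
Qed.

Lemma open_continuous_measurable_tuple (V : set 'rV[R]_m) (f : 'rV[R]_m -> R) :
  open V -> {in V, continuous f} ->
  measurable_fun (row_of_tuple @^-1` V) (f \o row_of_tuple).
Proof.
move=> oV cf; apply: (measurability _ (RGenOpens.measurableE R)).
move=> _ [_ [a [b ->] <-]].
rewrite (_ : _ `&` _ = row_of_tuple @^-1` (V `&` f @^-1` `]a, b[)).
  apply: open_measurable_tuple; rewrite openE => u [Vu fu].
  apply/filterI; first exact: open_nbhs_nbhs.
  by apply: (cf u); [rewrite inE|apply: open_nbhs_nbhs; split=> //; exact: interval_open].
by apply/seteqP; split.
Qed.

Lemma open_continuous_measurable_tuple_borel (X : ptopologicalType)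
    (V : set 'rV[R]_m) (f : 'rV[R]_m -> X) :
  open V -> {in V, continuous f} ->
  measurable_fun (row_of_tuple @^-1` V) (f \o row_of_tuple : _ -> borel X).
Proof.
move=> oV cf; apply: (@measurability _ _ _ (borel X) _ _ (@open X)) => // _ [A oA <-].
rewrite (_ : _ `&` _ = row_of_tuple @^-1` (V `&` f @^-1` A)).
  apply: open_measurable_tuple; rewrite openE => u [Vu fu].
  apply/filterI; first exact: open_nbhs_nbhs.
  by apply: (cf u); [rewrite inE|apply: open_nbhs_nbhs].
by apply/seteqP; split.
Qed.

End borel_tuples.

Lemma continuous_borel_measurable (R : realType) (X : ptopologicalType)
    (f : X -> R) : continuous f -> measurable_fun setT (f : borel X -> R).
Proof.
move=> /continuousP cf; apply: (measurability _ (RGenOpens.measurableE R)).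
move=> _ [_ [a [b ->] <-]]; rewrite setTI; apply: sub_sigma_algebra.
exact/cf/interval_open.
Qed.

(** * Functions of class C^1 *)

Lemma continuous_at_sum (R : realType) (T : topologicalType) (I : Type)
    (r : seq I) (P : pred I) (f : I -> T -> R) (x : T) :
  (forall i, {for x, continuous (f i)}) ->
  {for x, continuous (fun y => \sum_(i <- r | P i) f i y)}.
Proof.
move=> cf; apply: (cvg_big add_continuous) => i _.
exact: cf.
Qed.

Section differentiability.
Context {R : realType} {m : nat}.
Implicit Types (f g : 'rV[R]_m -> R) (u v w : 'rV[R]_m).

(** The condition is imposed near [u] and not only at [u]: it then holds at all nearby points, and
    partial derivatives can be computed there by the usual rules. *)
Definition C1_at f u : Prop := \forall w \near u, forall i : 'I_m,
  derivable f w (delta_mx 0 i) /\ {for w, continuous (partial i f)}.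

Lemma is_derive_line f w e (s d : R) :
  is_derive (w + s *: e) e f d <-> is_derive s 1 (fun r => f (w + r *: e)) d.
Proof.
have E : (fun h : R => h^-1 *: ((f \o shift (w + s *: e)) (h *: e) - f (w + s *: e)))
  = (fun h : R => h^-1 *: (((fun r => f (w + r *: e)) \o shift s) (h *: 1)
        - f (w + s *: e))).
  apply/funext => h /=; congr (_ *: (f _ - _)).
  by rewrite [h%:A]mulr1 scalerDl addrCA.
have E1 : derivable f (w + s *: e) e = derivable (fun r : R => f (w + r *: e)) s 1.
  by rewrite /derivable E.
have E2 : 'D_e f (w + s *: e) = 'D_1 (fun r : R => f (w + r *: e)) s.
  by rewrite /derive E.
by split=> -[d1 d2]; (apply: DeriveDef; [move: d1; rewrite E1|move: d2; rewrite E2]).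
Qed.

(** The intermediate point is located only by its absolute value, so that increments [c] of either
    sign are covered by one statement. *)
Lemma mean_value (h dh : R -> R) (c : R) :
    (forall s : R, `|s| <= `|c| -> is_derive s 1 h (dh s)) ->
  exists2 s, `|s| <= `|c| & h c - h 0 = c * dh s.
Proof.
move=> H.
have cont (a b : R) : (forall s, s \in `[a, b] -> `|s| <= `|c|) ->
    {within `[a, b], continuous h}.
  move=> ab; apply: continuous_in_subspaceT => s; rewrite inE => /ab /H[dhs _].
  exact/differentiable_continuous/derivable1_diffP.
have [c0|c0] := leP 0 c.
  have sub s : s \in `[0, c] -> `|s| <= `|c|.
    by rewrite in_itv/= => /andP[s0 sc]; rewrite !ger0_norm.
  have dhc s : s \in `]0, c[ -> is_derive s 1 h (dh s).
    by move=> /subset_itv_oo_cc /sub; exact: H.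
  have [s sc ->] := MVT_segment c0 dhc (cont _ _ sub).
  by exists s; [exact: sub|rewrite subr0 mulrC].
have sub s : s \in `[c, 0] -> `|s| <= `|c|.
  rewrite in_itv/= => /andP[cs s0].
  by rewrite (ler0_norm s0) (ltr0_norm c0) lerN2.
have dhc s : s \in `]c, 0[ -> is_derive s 1 h (dh s).
  by move=> /subset_itv_oo_cc /sub; exact: H.
have [s sc E] := MVT_segment (ltW c0) dhc (cont _ _ sub).
by exists s; [exact: sub|rewrite -opprB E sub0r mulrN opprK mulrC].
Qed.

Definition lform (a : 'rV[R]_m) v : R := \sum_i v 0 i * a 0 i.

Lemma lform_is_linear a : linear (lform a).
Proof.
move=> k u v; rewrite /lform scaler_sumr -big_split /=; apply: eq_bigr => i _.
by rewrite !mxE mulrDl -mulrA.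
Qed.

HB.instance Definition _ a :=
  GRing.isLinear.Build R 'rV[R]_m R _ (lform a) (lform_is_linear a).

Lemma lform_continuous a : continuous (lform a).
Proof.
apply: (continuous_big add_continuous) => // i _ u.
by apply: continuousM; [exact: coord_continuous|exact: cst_continuous].
Qed.

Lemma mx_norm_coord v i : `|v 0 i| <= `|v|.
Proof.
rewrite [leRHS]/Num.Def.normr/= mx_normrE.
exact: (le_bigmax _ (fun i : 'I_1 * 'I_m => `|v i.1 i.2|) (0, i)).
Qed.

Lemma mx_norm_le v (e : R) : 0 <= e -> (forall i, `|v 0 i| <= e) -> `|v| <= e.
Proof.
move=> e0 ve; rewrite [leLHS]/Num.Def.normr/= mx_normrE.
by apply: bigmax_le => // -[a i] _ /=; rewrite (ord1 a).
Qed.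

(* Telescope along the coordinate axes and apply the mean value theorem on
   each segment. *)
Lemma C1_at_diff f u : C1_at f u ->
  differentiable f u /\ 'd f u = lform (\row_i partial i f u) :> ('rV[R]_m -> R).
Proof.
move=> C1f.
suff H : f \o shift u = cst (f u) + lform (\row_i partial i f u)
    +o_ (0 : 'rV[R]_m) id.
  have E : 'd f u = lform (\row_i partial i f u) :> ('rV[R]_m -> R).
    by apply: diff_unique => //; exact: lform_continuous.
  split=> //; apply/diff_locallyP; rewrite E; split=> //.
  exact: lform_continuous.
apply/eqaddoP => e e0.
(* Each of the [m] coordinate steps may contribute an error [e' * |v|]. The denominator is [m.+1] so
   that it is nonzero when [m = 0]. *)
pose e' := e / m.+1%:R.
have e'0 : 0 < e' by rewrite divr_gt0.
have [r /= r0 rP] : exists2 r : R, 0 < r & forall w, `|w - u| <= r -> forall i,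
    derivable f w (delta_mx 0 i) /\ `|partial i f w - partial i f u| <= e'.
  have /nbhs_ballP[r /= r0 rP] : \forall w \near u, forall i : 'I_m,
      derivable f w (delta_mx 0 i) /\ `|partial i f w - partial i f u| <= e'.
    apply: (@filter_forall _ 'I_m (fun i w => derivable f w (delta_mx 0 i) /\
      `|partial i f w - partial i f u| <= e') (nbhs u) _) => i; apply: filterI.
      by near=> w; have /(_ i)[] : forall i : 'I_m,
        derivable f w (delta_mx 0 i) /\ {for w, continuous (partial i f)} by near: w.
    have /(_ i)[_] := nbhs_singleton C1f.
    by move=> /cvgr_dist_le /(_ _ e'0); apply: filterS => w; rewrite distrC.
  exists (r / 2); first by rewrite divr_gt0.
  move=> w wu; apply: rP; rewrite mx_norm_ball /ball_ /= distrC.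
  by rewrite (le_lt_trans wu)// ltr_pdivrMr// ltr_pMr// ltr1n.
near=> v.
have vr : `|v| <= r.
  by near: v; have := @nbhs0_le R 'rV[R]_m r r0.
(* [p k] keeps the first [k] coordinates of [v]: a path from [0] to [v] whose consecutive points
   differ in one coordinate. *)
pose p (k : nat) : 'rV[R]_m := \row_i (if (i < k)%N then v 0 i else 0).
have pS (k : 'I_m) : p k.+1 = p k + v 0 k *: delta_mx 0 k.
  apply/rowP => i; rewrite !mxE eqxx/= ltnS leq_eqVlt.
  have [->|ik] := eqVneq i k; first by rewrite eqxx ltnn/= mulr1 add0r.
  by move: ik; rewrite -val_eqE/= => /negbTE ->; rewrite mulr0 addr0.
have p0 : p 0 = 0 by apply/rowP => i; rewrite !mxE ltn0.
have pm : p m = v by apply/rowP => i; rewrite !mxE ltn_ord.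
have step (k : 'I_m) : `|f (u + p k.+1) - f (u + p k) - v 0 k * partial k f u|
    <= e' * `|v|.
  pose w s := u + p k + s *: delta_mx 0 k.
  have wP s : `|s| <= `|v 0 k| -> `|w s - u| <= r.
    move=> sv; rewrite /w addrC !addrA addNr add0r.
    apply: mx_norm_le; first exact: ltW.
    move=> i; rewrite !mxE eqxx/=.
    have [->|ik] := eqVneq i k.
      rewrite ltnn add0r mulr1 (le_trans sv)// (le_trans _ vr)//.
      exact: mx_norm_coord.
    rewrite mulr0 addr0; case: ifP => _; last by rewrite normr0 ltW.
    by rewrite (le_trans _ vr)// mx_norm_coord.
  have [s sv E] : exists2 s, `|s| <= `|v 0 k| &
      f (w (v 0 k)) - f (w 0) = v 0 k * partial k f (w s).
    apply: (mean_value (h := f \o w)) => s /wP /rP /(_ k)[dw _].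
    by apply/is_derive_line; split.
  rewrite pS addrA -/(w (v 0 k)).
  have -> : u + p k = w 0 by rewrite /w scale0r addr0.
  rewrite E -mulrBr normrM mulrC ler_pM// ?mx_norm_coord//.
  by have /rP/(_ k)[] := wP _ sv.
have -> : (f \o shift u - (cst (f u) + lform (\row_i partial i f u))) v =
    \sum_(k < m) (f (u + p k.+1) - f (u + p k) - v 0 k * partial k f u).
  rewrite sumrB -(big_mkord xpredT (fun k => f (u + p k.+1) - f (u + p k))).
  rewrite telescope_sumr// p0 pm addr0 -addrA -opprD [u + v]addrC.
  by congr (_ - (_ + _)); apply: eq_bigr => i _; rewrite mxE.
apply: (le_trans (ler_norm_sum _ _ _)).
apply: (@le_trans _ _ (\sum_(k < m) e' * `|v|)); first exact: ler_sum.
rewrite sumr_const card_ord -mulr_natl mulrA ler_wpM2r//.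
by rewrite /e' mulrA ler_pdivrMr// mulrC ler_wpM2l// ?ler_nat ?ltW.
Unshelve. all: by end_near. Qed.

End differentiability.

(** * Rules of calculus for functions of class C^1 *)

Section C1_calculus.
Context {R : realType}.

Lemma near_eq_continuous (T U : topologicalType) (f g : T -> U) x :
  (\near x, f x = g x) -> {for x, continuous f} -> {for x, continuous g}.
Proof.
move=> fg cf; rewrite /prop_for /continuous_at -(nbhs_singleton fg).
by apply: cvg_trans cf; apply: near_eq_cvg.
Qed.

Section scalar_functions.
Context {m : nat}.
Implicit Types (f g : 'rV[R]_m -> R) (u v w : 'rV[R]_m).

Lemma C1_at_near f u : C1_at f u -> \forall w \near u, C1_at f w.
Proof. exact: nbhs_interior. Qed.

Lemma C1_at_differentiable f u : C1_at f u -> differentiable f u.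
Proof. by case/C1_at_diff. Qed.

Lemma C1_at_is_derive f u i :
  C1_at f u -> is_derive u (delta_mx 0 i) f (partial i f u).
Proof. by move=> /nbhs_singleton/(_ i)[+ _]; split. Qed.

Lemma C1_at_partial_continuous f u i :
  C1_at f u -> {for u, continuous (partial i f)}.
Proof. by move=> /nbhs_singleton/(_ i)[]. Qed.

Lemma C1_at_continuous f u : C1_at f u -> {for u, continuous f}.
Proof. by move=> /C1_at_differentiable/differentiable_continuous. Qed.

Lemma C1_at_intro f (D : 'I_m -> 'rV[R]_m -> R) u :
  (\forall w \near u, forall i, is_derive w (delta_mx 0 i) f (D i w) /\
     {for w, continuous (D i)}) -> C1_at f u.
Proof.
move=> H; have H' := nbhs_interior H; apply: filterS H' => w Hw i.
have /(_ i)[[dfw _] cD] := nbhs_singleton Hw; split=> //.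
apply: near_eq_continuous cD; apply: filterS Hw => v /(_ i)[[_ <-] _].
by [].
Qed.

Lemma near_eq_partial f g u i : (\near u, f u = g u) ->
  partial i f u = partial i g u.
Proof. exact: near_eq_derive. Qed.

Lemma near_eq_C1_at f g u : (\near u, f u = g u) -> C1_at f u -> C1_at g u.
Proof.
move=> fg C1f; apply: (@C1_at_intro _ (fun i => partial i f)).
have fg' := nbhs_interior fg; near=> w => i; split; last first.
  by apply: C1_at_partial_continuous; near: w; exact: C1_at_near.
apply: (@near_eq_is_derive _ _ _ f); first by near: w.
by apply: C1_at_is_derive; near: w; exact: C1_at_near.
Unshelve. all: by end_near. Qed.

Lemma C1_at_cst (c : R) u : C1_at (cst c) u.
Proof.
apply: (@C1_at_intro _ (fun=> cst 0)); near=> w => i; split.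
  exact: is_derive_cst.
exact: cst_continuous.
Unshelve. all: by end_near. Qed.

Lemma is_derive_coord u v j : is_derive u v (fun w : 'rV[R]_m => w 0 j) (v 0 j).
Proof.
have [did eid] : is_derive u v (id : 'rV[R]_m -> 'rV[R]_m) v by exact: is_derive_id.
split; first by move/derivable_mxP : did; exact.
by move: (derive_mx did); rewrite eid => /rowP/(_ j); rewrite !mxE.
Qed.

Lemma C1_at_coord j u : C1_at (fun w : 'rV[R]_m => w 0 j) u.
Proof.
apply: (@C1_at_intro _ (fun i => cst ((delta_mx 0 i : 'rV[R]_m) 0 j))).
near=> w => i; split; first exact: is_derive_coord.
exact: cst_continuous.
Unshelve. all: by end_near. Qed.

Lemma C1_atD f g u : C1_at f u -> C1_at g u -> C1_at (f \+ g) u.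
Proof.
move=> C1f C1g; apply: (@C1_at_intro _ (fun i => partial i f \+ partial i g)).
near=> w => i.
have C1fw : C1_at f w by near: w; exact: C1_at_near.
have C1gw : C1_at g w by near: w; exact: C1_at_near.
split; first by apply: is_deriveD; exact: C1_at_is_derive.
by apply: continuousD; exact: C1_at_partial_continuous.
Unshelve. all: by end_near. Qed.

Lemma C1_atM f g u : C1_at f u -> C1_at g u -> C1_at (f \* g) u.
Proof.
move=> C1f C1g.
apply: (@C1_at_intro _ (fun i => f \* partial i g \+ g \* partial i f)).
near=> w => i.
have C1fw : C1_at f w by near: w; exact: C1_at_near.
have C1gw : C1_at g w by near: w; exact: C1_at_near.
split; first by apply: is_deriveM; exact: C1_at_is_derive.
by apply: continuousD; apply: continuousM;
  (exact: C1_at_partial_continuous || exact: C1_at_continuous).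
Unshelve. all: by end_near. Qed.

Lemma C1_atZ (c : R) f u : C1_at f u -> C1_at (fun w => c * f w) u.
Proof. by move=> C1f; apply: (C1_atM (C1_at_cst c u) C1f). Qed.

Lemma C1_at_sum (I : Type) (r : seq I) (P : pred I) (F : I -> 'rV[R]_m -> R) u :
  (forall i, C1_at (F i) u) -> C1_at (fun w => \sum_(i <- r | P i) F i w) u.
Proof.
move=> C1F; elim: r => [|i r IH].
  by under eq_fun do rewrite big_nil; exact: C1_at_cst.
under eq_fun do rewrite big_cons; case: (P i) => //.
by apply: C1_atD.
Qed.

Lemma C1_at_prod (I : Type) (r : seq I) (P : pred I) (F : I -> 'rV[R]_m -> R) u :
  (forall i, C1_at (F i) u) -> C1_at (fun w => \prod_(i <- r | P i) F i w) u.
Proof.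
move=> C1F; elim: r => [|i r IH].
  by under eq_fun do rewrite big_nil; exact: C1_at_cst.
under eq_fun do rewrite big_cons; case: (P i) => //.
by apply: C1_atM.
Qed.

Lemma is_derive_comp1 (h : R -> R) f u i : derivable h (f u) 1 -> C1_at f u ->
  is_derive u (delta_mx 0 i) (h \o f) (derive1 h (f u) * partial i f u).
Proof.
move=> dh C1f; have df := C1_at_differentiable C1f.
have dh' : differentiable h (f u) by apply/derivable1_diffP.
have dhf := differentiable_comp df dh'.
split; first exact: diff_derivable.
by rewrite deriveE// diff_comp//= diff1E//= -deriveE// mulrC.
Qed.

Lemma C1_at_comp1 (h : R -> R) f u : C1_at f u ->
  (\forall y \near f u, derivable h y 1 /\ {for y, continuous (derive1 h)}) ->
  C1_at (h \o f) u.
Proof.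
move=> C1f Hh.
apply: (@C1_at_intro _ (fun i => ((derive1 h) \o f) \* partial i f)).
have Hhf : \forall w \near u, derivable h (f w) 1 /\ {for f w, continuous (derive1 h)}.
  by have := C1_at_continuous C1f => /(_ _ Hh).
near=> w => i.
have C1fw : C1_at f w by near: w; exact: C1_at_near.
have [dh ch] : derivable h (f w) 1 /\ {for f w, continuous (derive1 h)} by near: w.
split; first exact: is_derive_comp1.
apply: continuousM; last exact: C1_at_partial_continuous.
by apply: continuous_comp => //; exact: C1_at_continuous.
Unshelve. all: by end_near. Qed.

Lemma C1_atV f u : f u != 0 -> C1_at f u -> C1_at (fun w => (f w)^-1) u.
Proof.
move=> fu0 C1f; apply: (C1_at_comp1 (h := GRing.inv)) => //.
have : \forall y \near f u, y != 0.
  by apply: open_nbhs_nbhs; split=> //; exact: open_neq.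
move=> /nbhs_interior; apply: filterS => y Hy.
have y0 := nbhs_singleton Hy.
have dinv (z : R) : z != 0 -> is_derive z 1 (GRing.inv : R -> R) (- z ^- 2).
  move=> z0; split; first exact: derivableV.
  by rewrite deriveV// derive_id scaler1 //.
split; first by case: (dinv y y0).
apply: (@near_eq_continuous _ _ (fun z : R => - z ^- 2)).
  by apply: filterS Hy => z /dinv[dz <-]; rewrite derive1E.
apply: continuousN; apply: continuousV; first by rewrite expf_neq0.
exact: exprn_continuous.
Qed.

End scalar_functions.

Section chain_rule.
Context {m n : nat}.
Implicit Types (f : 'rV[R]_n -> R) (T : 'rV[R]_m -> 'rV[R]_n).

Lemma differentiable_row T u :
  (forall j, differentiable (fun w => T w 0 j) u) -> differentiable T u.
Proof.
move=> dT; have -> : T = \sum_(j < n) (fun w => T w 0 j *: delta_mx 0 j).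
  by apply/funext => w; rewrite fct_sumE; exact: row_sum_delta.
by apply: differentiable_sum => j; exact: differentiableZl.
Qed.

Lemma diff_rowE T u v j : differentiable T u ->
  ('d T u v : 'rV[R]_n) 0 j = 'D_v (fun w => T w 0 j) u.
Proof.
move=> dT; rewrite -deriveE// derive_mx ?mxE//; exact: diff_derivable.
Qed.

Lemma jacobianE T u i j : (forall j, C1_at (fun w => T w 0 j) u) ->
  ('J T u) i j = partial i (fun w => T w 0 j) u.
Proof.
move=> C1T; rewrite mxE diff_rowE//.
by apply: differentiable_row => k; exact: C1_at_differentiable.
Qed.

Lemma is_derive_chain f T u i :
    (forall j, C1_at (fun w => T w 0 j) u) -> C1_at f (T u) ->
  is_derive u (delta_mx 0 i) (f \o T)
    (\sum_j partial i (fun w => T w 0 j) u * partial j f (T u)).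
Proof.
move=> C1T C1f.
have dT : differentiable T u.
  by apply: differentiable_row => k; exact: C1_at_differentiable.
have [df dfE] := C1_at_diff C1f.
have dfT := differentiable_comp dT df.
split; first exact: diff_derivable.
rewrite deriveE// diff_comp//= dfE /lform; apply: eq_bigr => j _.
by rewrite diff_rowE// mxE.
Qed.

Lemma C1_at_chain f T u :
  (forall j, C1_at (fun w => T w 0 j) u) -> C1_at f (T u) -> C1_at (f \o T) u.
Proof.
move=> C1T C1f.
apply: (@C1_at_intro _ _ (fun i w =>
  \sum_j partial i (fun v => T v 0 j) w * partial j f (T w))).
have cT : {for u, continuous T}.
  apply: differentiable_continuous.
  by apply: differentiable_row => k; exact: C1_at_differentiable.
have nT : \forall w \near u, forall j, C1_at (fun w => T w 0 j) w.
  apply: (@filter_forall _ 'I_n (fun j w => C1_at (fun w => T w 0 j) w) (nbhs u) _).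
  by move=> j; exact: C1_at_near.
have nf : \forall w \near u, C1_at f (T w).
  by have := cT _ (C1_at_near C1f).
near=> w => i.
have C1Tw : forall j, C1_at (fun w => T w 0 j) w by near: w.
have C1fw : C1_at f (T w) by near: w.
split; first exact: is_derive_chain.
have cTw : {for w, continuous T}.
  apply: differentiable_continuous.
  by apply: differentiable_row => k; exact: C1_at_differentiable.
apply: continuous_at_sum => j.
apply: (@continuousM _ _ (partial i (fun v => T v 0 j)) (partial j f \o T)).
  exact: C1_at_partial_continuous.
by apply: continuous_comp => //; exact: C1_at_partial_continuous.
Unshelve. all: by end_near. Qed.

End chain_rule.

End C1_calculus.

(** * Positive definite matrices and matrix functions of class C^1 *)

Definition posdefmx (R : realType) (m : nat) (A : 'M[R]_m) : Prop :=
  forall v : 'rV[R]_m, v != 0 -> 0 < (v *m A *m v^T) 0 0.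

Section positive_definite.
Context {R : realType} {m : nat}.
Implicit Types A : 'M[R]_m.

Lemma posdefmx_det_neq0 A : posdefmx A -> \det A != 0.
Proof.
move=> pA; apply/negP => /det0P[v v0 vA].
by have := pA v v0; rewrite vA mul0mx mxE ltxx.
Qed.

Lemma posdefmx_unit A : posdefmx A -> A \in unitmx.
Proof. by move=> /posdefmx_det_neq0; rewrite unitmxE unitfE. Qed.

Lemma rV_dotE (v : 'rV[R]_m) : (v *m v^T) 0 0 = \sum_i v 0 i ^+ 2.
Proof. by rewrite mxE; apply: eq_bigr => i _; rewrite mxE expr2. Qed.

Lemma rV_dot_gt0 (v : 'rV[R]_m) : v != 0 -> 0 < (v *m v^T) 0 0.
Proof.
move=> v0; rewrite rV_dotE lt_def sumr_ge0 ?andbT => [|i _]; last exact: sqr_ge0.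
apply: contra v0; rewrite psumr_eq0 => [|i _]; last exact: sqr_ge0.
move=> /allP H; apply/eqP/rowP => i; rewrite mxE.
by have := H i (mem_index_enum i); rewrite sqrf_eq0 => /eqP.
Qed.

(* The determinant does not vanish along the segment from 1 to A. *)
Lemma posdefmx_det_gt0 A : posdefmx A -> 0 < \det A.
Proof.
move=> pA; rewrite lt_def posdefmx_det_neq0//=.
case: (leP 0 (\det A)) => // detA.
(* The segment from 1 to [A] with a formal parameter: its determinant is a polynomial, so a negative
   value at 1 would produce a root between 0 and 1 by the intermediate value theorem for
   polynomials. *)
pose B : 'M[{poly R}]_m := 1%:M + 'X *: map_mx polyC (A - 1%:M).
have BE t : (\det B).[t] = \det (1%:M + t *: (A - 1%:M)).
  rewrite -[LHS]/(horner_eval t (\det B)) -det_map_mx; congr (\det _).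
  apply/matrixP => i j; rewrite !mxE /horner_eval /=.
  by rewrite horner_evalE; case: (i == j); rewrite ?mulr1n ?mulr0n !hornerE.
have [|t /andP[t0 t1] /rootP] := @poly_ivt R (- \det B) 0 1 ler01.
  rewrite !hornerN !BE scale0r addr0 det1 lerN10/= scale1r.
  by rewrite addrC subrK oppr_ge0 ltW.
rewrite hornerN BE => /eqP; rewrite oppr_eq0 => /eqP detB0.
suff /posdefmx_det_neq0/eqP : posdefmx (1%:M + t *: (A - 1%:M)) by [].
move=> v v0.
have -> : 1%:M + t *: (A - 1%:M) = (1 - t) *: 1%:M + t *: A.
  by rewrite scalerBr scalerBl scale1r addrCA addrC.
rewrite mulmxDr mulmxDl -!scalemxAr -!scalemxAl mulmx1 !mxE.
have := pA v v0; have := rV_dot_gt0 v0.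
rewrite [(v *m _) _ _]mxE [(v *m _ *m _) _ _]mxE => p1 p2.
have [->|tn0] := eqVneq t 0; first by rewrite subr0 mul1r mul0r addr0.
apply: ltr_wpDl; first by apply: mulr_ge0; [rewrite subr_ge0|exact: ltW].
by rewrite mulr_gt0// lt_def tn0.
Qed.

(** Positivity of [A] is applied to the row [v *m invmx A]; by symmetry of [A] the quadratic form
    takes there the value to be estimated. *)
Lemma posdefmx_inv A (v : 'rV[R]_m) : A^T = A -> posdefmx A -> v != 0 ->
  0 < (v *m invmx A *m v^T) 0 0.
Proof.
move=> sA pA v0; have uA := posdefmx_unit pA.
have := pA (v *m invmx A); rewrite trmx_mul trmx_inv sA mulmxKV// mulmxA.
apply; apply: contra v0 => /eqP vA.
by rewrite -[v](mulmxKV uA) vA mul0mx.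
Qed.

End positive_definite.

Section C1_matrices.
Context {R : realType} {m : nat}.

Lemma C1_at_det n (A : 'rV[R]_m -> 'M[R]_n) u :
  (forall i j, C1_at (fun w => A w i j) u) -> C1_at (fun w => \det (A w)) u.
Proof.
move=> C1A; apply: C1_at_sum => s; apply: C1_atZ.
by apply: C1_at_prod => i.
Qed.

(** By Cramer's rule the entries of the inverse are polynomials in the entries of [A] divided by the
    determinant. *)
Lemma C1_at_invmx n (A : 'rV[R]_m -> 'M[R]_n) u i j :
    (forall i j, C1_at (fun w => A w i j) u) ->
    (\forall w \near u, A w \in unitmx) ->
  C1_at (fun w => invmx (A w) i j) u.
Proof.
move=> C1A uA.
apply: (@near_eq_C1_at _ _ (fun w => (\det (A w))^-1 * (\adj (A w)) i j)).
  by apply: filterS uA => w uAw; rewrite /invmx uAw !mxE.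
apply: C1_atM; first apply: C1_atV.
- by have := nbhs_singleton uA; rewrite unitmxE unitfE.
- exact: C1_at_det.
- under eq_fun do rewrite mxE.
  apply: C1_atZ; apply: C1_at_det => k l.
  by under eq_fun do rewrite !mxE; exact: C1A.
Qed.

Lemma C1_at_sqrt (f : 'rV[R]_m -> R) u : 0 < f u -> C1_at f u ->
  C1_at (fun w => Num.sqrt (f w)) u.
Proof.
move=> fu0 C1f; apply: (C1_at_comp1 (h := Num.sqrt)) => //.
have : \forall y \near f u, 0 < y.
  by apply: open_nbhs_nbhs; split=> //; exact: open_gt.
move=> /nbhs_interior; apply: filterS => y Hy.
have y0 := nbhs_singleton Hy.
split; first by case: (is_derive1_sqrt y0).
apply: (@near_eq_continuous _ _ (fun z : R => (2 * Num.sqrt z)^-1)).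
  by apply: filterS Hy => z /is_derive1_sqrt[dz <-]; rewrite derive1E.
apply: continuousV; first by rewrite mulf_neq0// sqrtr_eq0 -ltNge.
by apply: continuousM; [exact: cst_continuous|exact: sqrt_continuous].
Qed.

End C1_matrices.

(** * Calculus in charts *)

Section smooth_C1.
Context {R : realType} {m : nat}.
Implicit Types (V : set 'rV[R]_m) (f : 'rV[R]_m -> R).

Lemma smooth_on_C1_at V f u : open V -> smooth_on V f -> V u -> C1_at f u.
Proof.
move=> oV sf Vu; apply: filterS (open_nbhs_nbhs (conj oV Vu)) => w Vw i.
have [_ /(_ i)[dfi [cfi _]]] := sf 1%N.
by split; [exact: dfi|apply: cfi; rewrite inE].
Qed.

Lemma smooth_on_partial V f i : smooth_on V f -> smooth_on V (partial i f).
Proof. by move=> sf k; have [_ /(_ i)[]] := sf k.+1. Qed.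

End smooth_C1.

Section manifold_calculus.
Context {R : realType} {m : nat} {X : smoothManifold R m}.
Variable G : riemannianMetric X.
Implicit Types (c d : chart R m X) (f g h : X -> R) (x : X).

Lemma chart_cod_map c x : chart_dom c x -> chart_cod c (chart_map c x).
Proof. by move=> cx; exists x. Qed.

Lemma chart_invK c u : chart_cod c u -> chart_map c (chart_inv c u) = u.
Proof. by move=> [x cx <-]; rewrite chart_mapK ?inE. Qed.

Lemma chart_inv_dom c u : chart_cod c u -> chart_dom c (chart_inv c u).
Proof. by move=> [x cx <-]; rewrite chart_mapK ?inE. Qed.

Lemma near_chart_dom c x : chart_dom c x -> \forall y \near x, chart_dom c y.
Proof. by move=> cx; apply: open_nbhs_nbhs; split=> //; exact: chart_dom_open. Qed.

Lemma near_chart_cod c x : chart_dom c x ->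
  \forall u \near chart_map c x, chart_cod c u.
Proof.
by move=> cx; apply: open_nbhs_nbhs; split;
  [exact: chart_cod_open|exact: chart_cod_map].
Qed.

Lemma near_chart_inv c x (P : set X) : chart_dom c x ->
  nbhs x P -> \forall u \near chart_map c x, P (chart_inv c u).
Proof.
move=> cx Px; have := chart_inv_continuous (mem_set (chart_cod_map cx)).
by apply; rewrite chart_mapK ?inE.
Qed.

Definition C1_fun f : Prop := forall c, atlas c -> forall x, chart_dom c x ->
  C1_at (f \o chart_inv c) (chart_map c x).

Lemma smooth_C1_fun f : smooth_fun f -> C1_fun f.
Proof.
move=> sf c ac x cx; apply: (smooth_on_C1_at _ (sf c ac)).
- exact: chart_cod_open.
- exact: chart_cod_map.
Qed.

Lemma exists_chart x : exists c, @atlas R m X c /\ chart_dom c x.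
Proof.
have [c ac cx] : (\bigcup_(c in @atlas R m X) chart_dom c) x by rewrite atlas_cover.
by exists c.
Qed.

Lemma C1_fun_continuous f : C1_fun f -> continuous f.
Proof.
move=> C1f x; have [c [ac cx]] := exists_chart x.
apply: (@near_eq_continuous _ _ ((f \o chart_inv c) \o chart_map c)).
  by apply: filterS (near_chart_dom cx) => y cy /=; rewrite chart_mapK ?inE.
apply: continuous_comp; first exact: chart_map_continuous (mem_set cx).
exact: C1_at_continuous (C1f c ac x cx).
Qed.

Lemma C1_fun_cst (a : R) : C1_fun (cst a).
Proof. by move=> c _ x _; exact: C1_at_cst. Qed.

Lemma C1_funD f g : C1_fun f -> C1_fun g -> C1_fun (f \+ g).
Proof. by move=> C1f C1g c ac x cx; apply: C1_atD; [exact: C1f|exact: C1g]. Qed.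

Lemma C1_funM f g : C1_fun f -> C1_fun g -> C1_fun (f \* g).
Proof. by move=> C1f C1g c ac x cx; apply: C1_atM; [exact: C1f|exact: C1g]. Qed.

Lemma C1_fun_sum (I : Type) (r : seq I) (F : I -> X -> R) :
  (forall i, C1_fun (F i)) -> C1_fun (fun x => \sum_(i <- r) F i x).
Proof. by move=> C1F c ac x cx; apply: C1_at_sum => i; exact: C1F. Qed.

Lemma C1_funV f : (forall x, f x != 0) -> C1_fun f -> C1_fun (fun x => (f x)^-1).
Proof.
by move=> f0 C1f c ac x cx; apply: C1_atV => /=; [exact: f0|exact: C1f].
Qed.

Lemma transition_C1 c d x j : atlas c -> atlas d ->
    chart_dom c x -> chart_dom d x ->
  C1_at (fun u => transition c d u 0 j) (chart_map c x).
Proof.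
move=> ac ad cx dx; apply: (smooth_on_C1_at _ (atlas_compatible ac ad j)).
  rewrite openE => _ [y [cy dy] <-]; rewrite /interior.
  have := near_chart_cod cy; have := near_chart_inv cy (near_chart_dom dy).
  apply: filterS2 => u du cu; exists (chart_inv c u); last exact: chart_invK.
  by split=> //; exact: chart_inv_dom.
by exists x.
Qed.

Definition dchart c f x : 'rV[R]_m :=
  \row_i partial i (f \o chart_inv c) (chart_map c x).

Lemma dchart_transition c d f x : atlas c -> atlas d ->
    chart_dom c x -> chart_dom d x -> C1_fun f ->
  dchart c f x = dchart d f x *m ('J (transition c d) (chart_map c x))^T.
Proof.
move=> ac ad cx dx C1f; apply/rowP => i; rewrite !mxE.
have C1T j := transition_C1 j ac ad cx dx.
have Tx : transition c d (chart_map c x) = chart_map d x.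
  by rewrite /transition /= chart_mapK ?inE.
have C1fd : C1_at (f \o chart_inv d) (transition c d (chart_map c x)).
  by rewrite Tx; exact: C1f.
rewrite (@near_eq_partial _ _ _ ((f \o chart_inv d) \o transition c d)); last first.
  apply: filterS (near_chart_inv cx (near_chart_dom dx)) => u du /=.
  by rewrite chart_mapK ?inE.
have [_] := is_derive_chain i C1T C1fd.
rewrite -/(partial i _ _) => ->; apply: eq_bigr => j _.
by rewrite [in RHS]mxE Tx mxE jacobianE// mulrC.
Qed.

Lemma gram_posdef_at c x : atlas c -> chart_dom c x ->
  posdefmx (gram G c (chart_map c x)).
Proof. by move=> ac cx v; apply: gram_posdef => //; exact: chart_cod_map. Qed.

Lemma gram_unit c u : atlas c -> chart_cod c u -> gram G c u \in unitmx.
Proof. by move=> ac cu; apply: posdefmx_unit => v; exact: gram_posdef. Qed.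

(** This is <grad f, grad g>: the gradients are the differentials times the inverse Gram matrix, and
    one of the two inverses cancels against the Gram matrix. *)
Definition metric_chart c f g x : R :=
  (dchart c f x *m invmx (gram G c (chart_map c x)) *m (dchart c g x)^T) 0 0.

(** A change of chart multiplies the differentials by [J^T] on the right and turns the Gram matrix
    [A] into [J *m A *m J^T]; the Jacobians cancel once the latter is inverted. *)
Lemma metric_chart_indep c d f g x : atlas c -> atlas d ->
    chart_dom c x -> chart_dom d x -> C1_fun f -> C1_fun g ->
  metric_chart c f g x = metric_chart d f g x.
Proof.
move=> ac ad cx dx C1f C1g; rewrite /metric_chart.
rewrite (dchart_transition ac ad cx dx C1f) (dchart_transition ac ad cx dx C1g).
have ug := gram_unit ac (chart_cod_map cx).
have ud := gram_unit ad (chart_cod_map dx).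
move: ug; rewrite (gram_transition _ ac ad cx dx) /=.
set J := 'J _ _; set A := gram G d _ => ug.
(* The Jacobian is invertible as a factor of an invertible Gram matrix; the inverse transition map
   is not differentiated. *)
have uJ : J \in unitmx by move: ug; rewrite !unitmx_mul => /andP[/andP[]].
have uJT : J^T \in unitmx by rewrite unitmx_tr.
have -> : invmx (J *m A *m J^T) = invmx J^T *m invmx A *m invmx J.
  apply: (can_inj (mulKmx ug)); rewrite mulmxV//.
  by rewrite !mulmxA mulmxK// mulmxK// mulmxV.
by rewrite trmx_mul trmxK !mulmxA mulmxK// mulmxKV.
Qed.

End manifold_calculus.

(** With [z] the imaginary unit this expands the complex-bilinear extension of a real form into its
    real constituents. *)
Lemma map_mx_bilinear (R S : comNzRingType) (f : {rmorphism R -> S}) (z : S) m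
    (A : 'M[R]_m) (a b c d : 'rV[R]_m) :
  ((map_mx f a + z *: map_mx f b) *m map_mx f A
     *m (map_mx f c + z *: map_mx f d)^T) 0 0 =
  f ((a *m A *m c^T) 0 0) + z * f ((a *m A *m d^T) 0 0) +
  (z * f ((b *m A *m c^T) 0 0) + z * z * f ((b *m A *m d^T) 0 0)).
Proof.
have addE (M N : 'M[S]_1) : (M + N) 0 0 = M 0 0 + N 0 0 by rewrite mxE.
have scaleE y (M : 'M[S]_1) : (y *: M) 0 0 = y * M 0 0 by rewrite mxE.
have mapE (M : 'M[R]_1) : map_mx f M 0 0 = f (M 0 0) by rewrite mxE.
rewrite linearD linearZ /= !map_trmx !mulmxDl !mulmxDr.
by rewrite -!scalemxAl -!scalemxAr -!map_mxM scalerA !addE !scaleE !mapE.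
Qed.

(** * The pairing of gradients, [kappa], and the divergence of f grad v *)

Section riemannian_calculus.
Context {R : realType} {m : nat} {X : smoothManifold R m}.
Variable G : riemannianMetric X.
Implicit Types (c d : chart R m X) (f g h : X -> R) (x : X).

Lemma dchartD c f g x : atlas c -> chart_dom c x -> C1_fun f -> C1_fun g ->
  dchart c (f \+ g) x = dchart c f x + dchart c g x.
Proof.
move=> ac cx C1f C1g; apply/rowP => i; rewrite !mxE.
have df := C1_at_is_derive i (C1f c ac x cx).
have dg := C1_at_is_derive i (C1g c ac x cx).
by have [_] := is_deriveD df dg.
Qed.

Lemma dchartM c f g x : atlas c -> chart_dom c x -> C1_fun f -> C1_fun g ->
  dchart c (f \* g) x = f x *: dchart c g x + g x *: dchart c f x.
Proof.
move=> ac cx C1f C1g; apply/rowP => i; rewrite !mxE.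
have df := C1_at_is_derive i (C1f c ac x cx).
have dg := C1_at_is_derive i (C1g c ac x cx).
have [_] := is_deriveM df dg; rewrite /= !chart_mapK ?inE//.
Qed.

Lemma dchart_cst c (a : R) x : dchart c (cst a) x = 0.
Proof. by apply/rowP => i; rewrite !mxE; exact: derive_cst. Qed.

Definition chart_of x : chart R m X := projT1 (cid (exists_chart x)).

Lemma chart_of_atlas x : atlas (chart_of x).
Proof. by rewrite /chart_of; case: cid => c []. Qed.

Lemma chart_of_dom x : chart_dom (chart_of x) x.
Proof. by rewrite /chart_of; case: cid => c []. Qed.

#[local] Hint Resolve chart_of_atlas chart_of_dom : core.

(** Choosing a chart around each point makes the pairing a function on the whole of [X]; for C^1
    functions the choice is immaterial by [metricE]. *)
Definition metric f g x : R := metric_chart G (chart_of x) f g x.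

Lemma metricE c f g x : atlas c -> chart_dom c x -> C1_fun f -> C1_fun g ->
  metric f g x = metric_chart G c f g x.
Proof. by move=> ac cx C1f C1g; exact: metric_chart_indep. Qed.


Lemma mx11_tr (M : 'M[R]_1) : M^T 0 0 = M 0 0.
Proof. by rewrite mxE. Qed.

Lemma metric_chart_sym c f g x : atlas c -> chart_dom c x ->
  metric_chart G c f g x = metric_chart G c g f x.
Proof.
move=> ac cx; rewrite /metric_chart -[LHS]mx11_tr !trmx_mul trmxK trmx_inv.
by rewrite gram_sym ?mulmxA//; exact: chart_cod_map.
Qed.

Lemma metric_sym f g x : metric f g x = metric g f x.
Proof. exact: metric_chart_sym. Qed.

Lemma metricDl f g h x : C1_fun f -> C1_fun g ->
  metric (f \+ g) h x = metric f h x + metric g h x.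
Proof.
by move=> C1f C1g; rewrite /metric /metric_chart dchartD// !mulmxDl mxE.
Qed.

Lemma metricMl f g h x : C1_fun f -> C1_fun g ->
  metric (f \* g) h x = f x * metric g h x + g x * metric f h x.
Proof.
move=> C1f C1g; rewrite /metric /metric_chart dchartM// !mulmxDl mxE.
by rewrite -!scalemxAl !mxE.
Qed.

Lemma metric_cstl (a : R) h x : metric (cst a) h x = 0.
Proof. by rewrite /metric /metric_chart dchart_cst !mul0mx mxE. Qed.

Lemma metric_ge0 f x : 0 <= metric f f x.
Proof.
rewrite /metric /metric_chart.
have [->|d0] := eqVneq (dchart (chart_of x) f x) 0.
  by rewrite !mul0mx mxE.
apply/ltW/posdefmx_inv => //; last exact: gram_posdef_at.
by apply: gram_sym => //; exact: chart_cod_map.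
Qed.

(** The inverse Gram matrix is definite, so the hypothesis forces the differential of [f] to vanish
    at [x]. *)
Lemma metric_eq0 f g x : metric f f x = 0 -> metric f g x = 0.
Proof.
rewrite /metric /metric_chart.
have [->|d0] := eqVneq (dchart (chart_of x) f x) 0.
  by rewrite !mul0mx mxE.
move=> f0; suff : 0 < metric f f x by rewrite /metric /metric_chart f0 ltxx.
apply: posdefmx_inv => //; last exact: gram_posdef_at.
by apply: gram_sym => //; exact: chart_cod_map.
Qed.

Lemma gram_C1_at c i j u : atlas c -> chart_cod c u ->
  C1_at (fun w => gram G c w i j) u.
Proof.
move=> ac cu; apply: (smooth_on_C1_at _ (gram_smooth G ac i j)) => //.
exact: chart_cod_open.
Qed.

Lemma near_cod c u : chart_cod c u -> \forall w \near u, chart_cod c w.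
Proof. by move=> cu; apply: open_nbhs_nbhs; split=> //; exact: chart_cod_open. Qed.

Lemma invgram_C1_at c i j u : atlas c -> chart_cod c u ->
  C1_at (fun w => invmx (gram G c w) i j) u.
Proof.
move=> ac cu; apply: C1_at_invmx => [k l|]; first exact: gram_C1_at.
by apply: filterS (near_cod cu) => w; exact: gram_unit.
Qed.

Lemma metric_continuous f g : C1_fun f -> C1_fun g -> continuous (metric f g).
Proof.
move=> C1f C1g x; set c := chart_of x.
have ac : atlas c := chart_of_atlas x.
have cx : chart_dom c x := chart_of_dom x.
pose M w := \sum_i (\sum_j partial j (f \o chart_inv c) w *
  invmx (gram G c w) j i) * partial i (g \o chart_inv c) w.
apply: (@near_eq_continuous _ _ (M \o chart_map c)).
  apply: filterS (near_chart_dom cx) => y cy; rewrite (@metricE c)//.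
  rewrite /metric_chart mxE; apply: eq_bigr => i _; rewrite !mxE; congr (_ * _).
  by apply: eq_bigr => j _; rewrite !mxE.
apply: continuous_comp; first exact: chart_map_continuous (mem_set cx).
apply: continuous_at_sum => i; apply: continuousM.
  apply: continuous_at_sum => j; apply: continuousM.
    exact: C1_at_partial_continuous (C1f c ac x cx).
  by apply: C1_at_continuous; apply: invgram_C1_at => //; exact: chart_cod_map.
exact: C1_at_partial_continuous (C1g c ac x cx).
Qed.

(** The extension to complex vectors is bilinear, without conjugation, whence the minus sign. The
    Gram matrix in [cmetric] cancels one of the inverses contained in the two gradients. *)
Lemma kappaE c f1 f2 g1 g2 x : atlas c -> chart_dom c x ->
    C1_fun f1 -> C1_fun f2 -> C1_fun g1 -> C1_fun g2 ->
  kappa G c (fun y => f1 y +i* f2 y) (fun y => g1 y +i* g2 y) x =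
  (metric f1 g1 x - metric f2 g2 x) +i* (metric f1 g2 x + metric f2 g1 x).
Proof.
move=> ac cx C1f1 C1f2 C1g1 C1g2; rewrite !(@metricE c)//.
rewrite /kappa /cmetric /=.
set u := chart_map c x; set A := gram G c u.
have uA : A \in unitmx by apply: gram_unit => //; exact: chart_cod_map.
have sA : A^T = A by apply: gram_sym => //; exact: chart_cod_map.
have E f h : (grad G c f u *m A *m (grad G c h u)^T) 0 0 = metric_chart G c f h x.
  rewrite /grad /metric_chart -/(dchart c f x) -/(dchart c h x) -/u -/A mulmxKV//.
  by rewrite trmx_mul trmx_inv sA mulmxA.
have cgradE f h : cgrad G c (fun y => f y +i* h y) x =
    map_mx (real_complex R) (grad G c f u) +
    'i *: map_mx (real_complex R) (grad G c h u).
  apply/rowP => i; rewrite !mxE -/u.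
  by apply/eqP; rewrite eq_complex /=; apply/andP; split; apply/eqP; ring.
rewrite !cgradE map_mx_bilinear !E.
by apply/eqP; rewrite eq_complex /=; apply/andP; split; apply/eqP; ring.
Qed.

Lemma sqrt_det_gt0 c u : atlas c -> chart_cod c u -> 0 < sqrt_det G c u.
Proof.
move=> ac cu; rewrite /sqrt_det sqrtr_gt0; apply: posdefmx_det_gt0 => v.
exact: gram_posdef.
Qed.

Lemma sqrt_det_C1_at c u : atlas c -> chart_cod c u -> C1_at (sqrt_det G c) u.
Proof.
move=> ac cu; apply: C1_at_sqrt.
  by rewrite -sqrtr_gt0; exact: (sqrt_det_gt0 ac cu).
by apply: C1_at_det => i j; exact: gram_C1_at.
Qed.

Lemma grad_C1_at c f i u : smooth_fun f -> atlas c -> chart_cod c u ->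
  C1_at (fun w => grad G c f w 0 i) u.
Proof.
move=> sf ac cu; rewrite /grad; under eq_fun do rewrite mxE.
apply: C1_at_sum => j; apply: C1_atM; last exact: invgram_C1_at.
under eq_fun do rewrite mxE.
apply: (smooth_on_C1_at _ (smooth_on_partial j (sf c ac))) => //.
exact: chart_cod_open.
Qed.

(** The field f grad v weighted by the volume density, so that its Euclidean divergence is what has
    to be integrated over R^m. *)
Definition flux c f v (u : 'rV[R]_m) (i : 'I_m) : R :=
  f (chart_inv c u) * (sqrt_det G c u * grad G c v u 0 i).

Lemma flux_C1_at c f v i u : C1_fun f -> smooth_fun v -> atlas c ->
  chart_cod c u -> C1_at (fun w => flux c f v w i) u.
Proof.
move=> C1f sv ac cu; apply: C1_atM.
  rewrite -(chart_invK cu); apply: C1f => //; exact: chart_inv_dom.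
by apply: C1_atM; [exact: sqrt_det_C1_at|exact: grad_C1_at].
Qed.

(** The product rule: differentiating the density times grad v gives the Laplacian, whose factor
    [sqrt_det^-1] is cancelled by the density, and differentiating [f] gives <grad f, grad v>. *)
Lemma divergence_flux c f v x : C1_fun f -> smooth_fun v -> atlas c ->
    chart_dom c x ->
  (f x * laplacian G c v x + metric f v x) * sqrt_det G c (chart_map c x) =
  \sum_i partial i (fun w => flux c f v w i) (chart_map c x).
Proof.
move=> C1f sv ac cx; set u := chart_map c x.
have cu : chart_cod c u by exact: chart_cod_map.
have s0 : sqrt_det G c u != 0 by rewrite gt_eqF// sqrt_det_gt0.
have C1v := smooth_C1_fun sv.
rewrite metric_sym (@metricE c)// /metric_chart /laplacian /div -/u.
rewrite mulrDl -mulrA [_^-1 * _]mulrC divfK// mxE mulr_sumr mulr_suml.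
rewrite -big_split /=; apply: eq_bigr => i _.
have C1fc : C1_at (f \o chart_inv c) u by exact: C1f.
have C1s : C1_at (fun w => sqrt_det G c w * grad G c v w 0 i) u.
  by apply: C1_atM; [exact: sqrt_det_C1_at|exact: grad_C1_at].
have [_] := is_deriveM (C1_at_is_derive i C1fc) (C1_at_is_derive i C1s).
rewrite -/(partial i _ _) => E; rewrite [RHS]E /= /u chart_mapK ?inE// -/u.
congr (_ + _).
have -> : (dchart c f x)^T i 0 = partial i (f \o chart_inv c) u by rewrite !mxE.
by rewrite -/(grad G c v u) /GRing.scale /= mulrAC [_ * sqrt_det _ _ _]mulrC.
Qed.

End riemannian_calculus.

(** * Integration in a chart *)

Section chart_integral.
Context {R : realType} {m : nat} {X : smoothManifold R m}.
Variables (G : riemannianMetric X) (vol : {measure set (borel X) -> \bar R}).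
Hypothesis volG : riemannian_volume G vol.
Variables (c : chart R m X) (ac : atlas c).

Local Notation cod := (@row_of_tuple R m @^-1` chart_cod c).
Local Notation psi := (fun t : m.-tuple R => chart_inv c (row_of_tuple t)).
Local Notation dens := (fun t : m.-tuple R => sqrt_det G c (row_of_tuple t)).

Lemma open_measurable_borel (A : set X) : open A -> measurable (A : set (borel X)).
Proof. exact: sub_sigma_algebra. Qed.

Lemma chart_dom_measurable : measurable (chart_dom c : set (borel X)).
Proof. by apply: open_measurable_borel; exact: chart_dom_open. Qed.

Lemma chart_cod_measurable : measurable cod.
Proof. by apply: open_measurable_tuple; exact: chart_cod_open. Qed.

Lemma chart_inv_measurable : measurable_fun cod (psi : _ -> borel X).
Proof.
apply: open_continuous_measurable_tuple_borel; first exact: chart_cod_open.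
exact: chart_inv_continuous.
Qed.

Lemma density_measurable : measurable_fun cod dens.
Proof.
apply: open_continuous_measurable_tuple; first exact: chart_cod_open.
by move=> u /set_mem cu; apply/C1_at_continuous/sqrt_det_C1_at.
Qed.

Lemma density_ge0 t : 0 <= dens t.
Proof. exact: sqrtr_ge0. Qed.

Lemma volume_chart (A : set (borel X)) : measurable A ->
  vol (A `&` chart_dom c) =
  (\int[lebesgue_tuple m]_(t in cod) ((\1_A (psi t) * dens t)%:E))%E.
Proof.
move=> mA; rewrite (volG ac); last 2 first.
- by apply: measurableI => //; exact: chart_dom_measurable.
- exact: subIsetr.
have -> : [set t : m.-tuple R | (chart_map c @` (A `&` chart_dom c)) (\row_i tnth t i)]
    = cod `&` psi @^-1` A.
  apply/seteqP; split=> t /=; rewrite -/(row_of_tuple t).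
    move=> [x [Ax cx] xt]; split; first by exists x.
    by rewrite -xt chart_mapK ?inE.
  move=> [ct At]; exists (psi t); last exact: chart_invK.
  by split=> //; exact: chart_inv_dom.
rewrite integral_mkcondr; apply: eq_integral => t _; rewrite patchE indicE.
have -> : (t \in psi @^-1` A) = (psi t \in A).
  by apply/idP/idP; rewrite !inE.
by case: (psi t \in A); rewrite ?mul1r ?mul0r.
Qed.

Import HBNNSimple.

Lemma chart_integral_nnsfun (f : {nnsfun (borel X) >-> R}) :
  (\int[vol]_(x in chart_dom c) (f x)%:E =
   \int[lebesgue_tuple m]_(t in cod) (f (psi t) * dens t)%:E)%E.
Proof.
have mU := chart_dom_measurable; have mD := chart_cod_measurable.
have mpsi := chart_inv_measurable; have mdens := density_measurable.
have mpre r : measurable (cod `&` psi @^-1` (f @^-1` [set r])).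
  by apply: mpsi => //; exact: measurable_sfunP.
have mind r : measurable_fun cod (fun t => \1_(f @^-1` [set r]) (psi t) : R).
  by apply: (@measurableT_comp _ _ _ _ _ _ (\1_(f @^-1` [set r]) : borel X -> R)).
have nnind r x : 0 <= r * \1_(f @^-1` [set r]) x.
  by rewrite -lee_fin EFinM nnfun_muleindic_ge0.
under eq_integral do rewrite fimfunE -fsumEFin//.
rewrite ge0_integral_fsum//; last 2 first.
- by move=> r; apply/measurable_EFinP/measurable_funTS/measurable_funM.
- by move=> r x _; rewrite lee_fin nnind.
under [RHS]eq_integral.
  move=> t _; rewrite fimfunE mulr_fsuml -fsumEFin//.
  over.
rewrite ge0_integral_fsum//; last 2 first.
- move=> r; apply/measurable_EFinP/measurable_funM => //.
  by apply: measurable_funM => //; exact: measurable_cst.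
- by move=> r t _; rewrite lee_fin mulr_ge0 ?density_ge0.
apply: eq_fsbigr => r _.
(* A negative [r] is not a value of [f] and contributes 0 to both sides; for the others,
   nonnegativity allows [r] to leave the integrals. *)
have [r0|r0] := ltP r 0.
  have f0 x : \1_(f @^-1` [set r]) x = 0 :> R.
    by rewrite preimage_nnfun0// indicE in_set0.
  rewrite (eq_integral (cst 0%E)) => [|x _]; last by rewrite f0 mulr0.
  rewrite [RHS](eq_integral (cst 0%E)) => [|t _]; last by rewrite f0 mulr0 mul0r.
  by rewrite !integral0.
under eq_integral do rewrite EFinM.
under [RHS]eq_integral do rewrite -mulrA EFinM.
rewrite !ge0_integralZl_EFin//=.
- by rewrite integral_indic//= volume_chart.
- by move=> t _; rewrite lee_fin mulr_ge0 ?density_ge0.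
- by apply/measurable_EFinP/measurable_funM.
- exact/measurable_EFinP.
Qed.

Lemma chart_integral_ge0 (F : borel X -> \bar R) :
    measurable_fun (chart_dom c : set (borel X)) F -> (forall x, 0 <= F x)%E ->
  (\int[vol]_(x in chart_dom c) F x =
   \int[lebesgue_tuple m]_(t in cod) (F (psi t) * (dens t)%:E))%E.
Proof.
have mU := chart_dom_measurable; have mD := chart_cod_measurable.
have mpsi := chart_inv_measurable; have mdens := density_measurable.
move=> mF F0; pose f_ := nnsfun_approx mU mF.
transitivity (limn (fun n => \int[vol]_(x in chart_dom c) (f_ n x)%:E)%E).
  rewrite -monotone_convergence//.
  - apply: eq_integral => x; rewrite inE => cx; apply/esym/cvg_lim => //.
    by apply: cvg_nnsfun_approx => // *; exact: F0.
  - by move=> n; exact/measurable_EFinP/measurable_funTS/measurable_funP.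
  - by move=> n x _; rewrite lee_fin.
  - by move=> x _ k n kn; rewrite lee_fin; exact/lefP/nd_nnsfun_approx.
under eq_fun do rewrite chart_integral_nnsfun.
rewrite -monotone_convergence//.
- apply: eq_integral => t; rewrite inE => ct; apply/cvg_lim => //.
  under eq_cvg do rewrite EFinM.
  apply: cvgeZr => //; apply: cvg_nnsfun_approx => //.
  exact: chart_inv_dom.
- move=> n; apply/measurable_EFinP/measurable_funM => //.
  by apply: (@measurableT_comp _ _ _ _ _ _ (f_ n : borel X -> R)).
- by move=> n t _; rewrite lee_fin mulr_ge0 ?density_ge0.
- move=> t _ k n kn; rewrite lee_fin; apply: ler_wpM2r; first exact: density_ge0.
  by have /lefP := nd_nnsfun_approx mU mF kn; apply.
Qed.

(** The positive and the negative part of [F] are transported separately; since the density is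
    nonnegative, multiplying by it commutes with taking these parts. *)
Lemma chart_integral (F : borel X -> R) : measurable_fun setT F ->
    (forall x, ~ chart_dom c x -> F x = 0) ->
  (\int[vol]_x (F x)%:E =
   \int[lebesgue_tuple m]_(t in cod) (F (psi t) * dens t)%:E)%E.
Proof.
move=> mF F0.
have -> : (\int[vol]_x (F x)%:E = \int[vol]_(x in chart_dom c) (F x)%:E)%E.
  rewrite [RHS]integral_mkcond; apply: eq_integral => x _; rewrite patchE.
  by case: ifPn => //; rewrite notin_setE => /F0 ->.
have mFU : measurable_fun (chart_dom c : set (borel X)) (EFin \o F).
  exact/measurable_EFinP/measurable_funTS.
rewrite integralE [RHS]integralE; congr (_ - _)%E.
- rewrite chart_integral_ge0//; last exact: measurable_funepos.
  apply: eq_integral => t _; rewrite !funeposE/=.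
  by rewrite maxe_pMl ?lee_fin ?density_ge0// mul0e EFinM.
- rewrite chart_integral_ge0//; last exact: measurable_funeneg.
  apply: eq_integral => t _; rewrite !funenegE/=.
  by rewrite maxe_pMl ?lee_fin ?density_ge0// mul0e -EFinM mulNr.
Qed.

End chart_integral.

(** * Green's formula *)

Section boxes.
Context {R : realType} {m : nat}.

Definition closed_box (p : 'rV[R]_m) (r : R) : set 'rV[R]_m :=
  [set u | `|u - p| <= r].

Lemma closed_box_compact p r : compact (closed_box p r).
Proof.
apply: bounded_closed_compact.
  exists (`|p| + r); split; first exact: num_real.
  move=> M prM u /= up; apply: le_trans (ltW prM).
  by rewrite -[u](subrK p) (le_trans (ler_normD _ _))// addrC lerD2l.
have -> : closed_box p r = (fun u => `|u - p|) @^-1` [set s | s <= r] by [].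
apply: preimage_closed; last exact: closed_le.
move=> u _; apply: continuous_comp; last exact: norm_continuous.
by apply: continuousB; [exact: id|exact: cst_continuous].
Qed.

Lemma near_outside_box p r (u : 'rV[R]_m) : r < `|u - p| ->
  \forall w \near u, r < `|w - p|.
Proof.
have cn : {for u, continuous (fun w : 'rV[R]_m => `|w - p|)}.
  apply: continuous_comp; last exact: norm_continuous.
  by apply: continuousB; [exact: id|exact: cst_continuous].
move=> ru; have rn : nbhs `|u - p| [set s | r < s].
  by apply: open_nbhs_nbhs; split=> //; exact: open_gt.
by have := cn _ rn.
Qed.

Lemma compact_support_bounded p r (g : 'rV[R]_m -> R) :
    continuous g -> (forall u, r < `|u - p| -> g u = 0) ->
  exists C, forall u, `|g u| <= C.
Proof.
move=> cg g0.
have /compact_bounded[M [_ HM]] : compact (g @` closed_box p r).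
  apply: continuous_compact; last exact: closed_box_compact.
  exact: continuous_subspaceT.
exists (`|M| + 1) => u.
have [ur|ru] := leP (`|u - p|) r; last by rewrite g0// normr0 addr_ge0.
by apply: HM; [rewrite ltr_pwDr// ler_norm|exists u].
Qed.

End boxes.

Section chart_boxes.
Context {R : realType} {m : nat} {X : smoothManifold R m}.
Implicit Types (c : chart R m X) (f g : X -> R).

Lemma closed_box_inv_closed c (p : 'rV[R]_m) (r : R) :
  closed_box p r `<=` chart_cod c -> closed (chart_inv c @` closed_box p r).
Proof.
move=> box_cod; apply: compact_closed; first exact: manifold_hausdorff.
apply: continuous_compact; last exact: closed_box_compact.
apply: continuous_in_subspaceT => u; rewrite inE => /box_cod cu.
by apply: chart_inv_continuous; rewrite inE.
Qed.

Lemma near_eq0_metric (G : riemannianMetric X) f g x :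
  (\forall y \near x, f y = 0) -> metric G f g x = 0.
Proof.
move=> f0; rewrite /metric /metric_chart.
rewrite (_ : dchart _ f x = 0) ?mul0mx ?mxE//; apply/rowP => i; rewrite !mxE.
rewrite (@near_eq_partial _ _ _ (cst 0)); first exact: derive_cst.
exact: (near_chart_inv (chart_of_dom x) f0).
Qed.

End chart_boxes.

Section local_green.
Context {R : realType} {m : nat} {X : smoothManifold R m}.
Variables (G : riemannianMetric X) (vol : {measure set (borel X) -> \bar R}).
Hypothesis volG : riemannian_volume G vol.
Variables (c : chart R m X) (ac : atlas c).
Variables (p : 'rV[R]_m) (r : R).
Variables (f v l : X -> R).
Hypotheses (C1f : C1_fun f) (sv : smooth_fun v) (cl : continuous l).
Hypothesis f_supp : forall x, f x != 0 ->
  chart_dom c x /\ closed_box p r (chart_map c x).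
Hypothesis box_cod : closed_box p r `<=` chart_cod c.
Hypothesis lapE : forall x, chart_dom c x -> laplacian G c v x = l x.

(** Outside the image of the chart [flux] carries no meaning. Replacing it there by 0 gives a C^1
    function on all of R^m, because [f] vanishes outside a closed box contained in the image. *)
Let Y (i : 'I_m) (w : 'rV[R]_m) : R :=
  if `[< chart_cod c w >] then flux G c f v w i else 0.

Let Y_far i w : r < `|w - p| -> Y i w = 0.
Proof.
move=> rw; rewrite /Y; case: asboolP => // cw.
rewrite /flux (_ : f _ = 0) ?mul0r//; apply/eqP/negPn/negP => /f_supp[_].
by rewrite chart_invK// /closed_box /= leNgt rw.
Qed.

Let Y_flux i u : chart_cod c u -> \forall w \near u, flux G c f v w i = Y i w.
Proof.
move=> cu; apply: filterS (near_cod cu) => w cw.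
by rewrite /Y; case: asboolP.
Qed.

Let Y_C1 i u : C1_at (Y i) u.
Proof.
have [cu|ncu] := pselect (chart_cod c u).
  apply: near_eq_C1_at (Y_flux i cu) _; exact: flux_C1_at.
have ru : r < `|u - p|.
  by rewrite ltNge; apply/negP => /box_cod.
apply: (@near_eq_C1_at _ _ (cst 0)); last exact: C1_at_cst.
by apply: filterS (near_outside_box ru) => w /Y_far ->.
Qed.

Let dY_far i u : r < `|u - p| -> partial i (Y i) u = 0.
Proof.
move=> ru; rewrite (@near_eq_partial _ _ _ (cst 0)); first exact: derive_cst.
by apply: filterS (near_outside_box ru) => w /Y_far ->.
Qed.

Let dY_continuous i : continuous (partial i (Y i)).
Proof. by move=> u; exact: C1_at_partial_continuous. Qed.

Let dY_measurable i :
  measurable_fun setT (partial i (Y i) \o @row_of_tuple R m).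
Proof.
rewrite -[setT](preimage_setT (@row_of_tuple R m)).
by apply: open_continuous_measurable_tuple => [|u _]; [exact: openT|].
Qed.

(** A coordinate of absolute value at least [K] puts the point outside the box around [p]; the
    summand 1 makes the inequality in [norm_far] strict. *)
Let K := `|p| + r + 1.

Let norm_far (t : m.-tuple R) (j : 'I_m) :
  K <= `|tnth t j| -> r < `|row_of_tuple t - p|.
Proof.
move=> Kt; have := mx_norm_coord (row_of_tuple t) j; rewrite mxE => tj.
have := ler_normD (row_of_tuple t - p) p; rewrite subrK => tp.
rewrite /K in Kt; lra.
Qed.

Let integral_dY i :
  (\int[lebesgue_tuple m]_t (partial i (Y i) (row_of_tuple t))%:E = 0)%E.
Proof.
have [C dYC] := compact_support_bounded (@dY_continuous i) (@dY_far i).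
apply: (@integral_lebesgue_tuple_derivative _ _ i (Y i \o @row_of_tuple R m)
  (partial i (Y i) \o @row_of_tuple R m) K C) => //=.
- by move=> t j /norm_far; exact: Y_far.
- by move=> t j /norm_far; exact: dY_far.
- move=> t s.
  (* The line in direction [i] is started where its [i]-th coordinate is 0, so that the parameter is
     that coordinate itself. *)
  pose w0 := row_of_tuple t - tnth t i *: delta_mx 0 i.
  have wE s' : row_of_tuple (set_tnth i t s') = w0 + s' *: delta_mx 0 i.
    apply/rowP => j; rewrite !mxE tnth_mktuple eqxx/=.
    by have [->|] := eqVneq j i; rewrite ?mulr1 ?mulr0 ?subrr ?add0r ?subr0 ?addr0.
  rewrite wE (_ : _ \o _ = (fun s' => Y i (w0 + s' *: delta_mx 0 i))).
    by apply/is_derive_line; exact: C1_at_is_derive.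
  by apply/funext => s' /=; rewrite wE.
- move=> t.
  pose w0 := row_of_tuple t - tnth t i *: delta_mx 0 i.
  have wE s' : row_of_tuple (set_tnth i t s') = w0 + s' *: delta_mx 0 i.
    apply/rowP => j; rewrite !mxE tnth_mktuple eqxx/=.
    by have [->|] := eqVneq j i; rewrite ?mulr1 ?mulr0 ?subrr ?add0r ?subr0 ?addr0.
  rewrite (_ : _ \o _ = partial i (Y i) \o (fun s' => w0 + s' *: delta_mx 0 i)).
    move=> s; apply: continuous_comp; last exact: dY_continuous.
    apply: (@continuousD _ _ _ (cst w0) (fun s' : R => s' *: delta_mx 0 i)).
      exact: cst_continuous.
    exact: scalel_continuous.
  by apply/funext => s' /=; rewrite wE.
Qed.

Let integrable_dY i : (lebesgue_tuple m).-integrable setT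
  (fun t => (partial i (Y i) (row_of_tuple t))%:E).
Proof.
have [C dYC] := compact_support_bounded (@dY_continuous i) (@dY_far i).
apply: (@integrable_bounded_support _ _ _ _ (@tuple_box R m K)
  (partial i (Y i) \o @row_of_tuple R m) C) => //=.
- exact: measurable_tuple_box.
- exact: lebesgue_tuple_box_lty.
- by move=> t /existsNP[j /negP]; rewrite -ltNge => /ltW /norm_far; exact: dY_far.
Qed.

(** Read in the chart, the integrand times the density is the sum of the [partial i (Y i)], each of
    which has integral 0. *)
Lemma local_green : (\int[vol]_x (f x * l x + metric G f v x)%:E = 0)%E.
Proof.
have C1v := smooth_C1_fun sv.
have cF : continuous (fun x => f x * l x + metric G f v x).
  move=> x; apply: (@continuousD _ _ _ (f \* l) (metric G f v)).
    by apply: continuousM; [exact: C1_fun_continuous|exact: cl].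
  exact: metric_continuous.
rewrite (chart_integral volG ac) /=; last 2 first.
- exact: continuous_borel_measurable.
(* Outside the chart domain [f] vanishes not only at [x] but near [x], which also kills its
   gradient: the preimage of the box is compact, hence closed as [X] is Hausdorff, and it does not
   contain [x]. *)
- move=> x ncx; have f0 : \forall y \near x, f y = 0.
    have cK := closed_box_inv_closed box_cod.
    have nKx : (~` (chart_inv c @` closed_box p r)) x.
      by move=> [u /box_cod cu ux]; apply: ncx; rewrite -ux; exact: chart_inv_dom.
    have : \forall y \near x, (~` (chart_inv c @` closed_box p r)) y.
      by apply: open_nbhs_nbhs; split=> //; exact: closed_openC.
    apply: filterS => y nKy; apply/eqP/negPn/negP => /f_supp[cy yb].
    by apply: nKy; exists (chart_map c y) => //; rewrite chart_mapK ?inE.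
  by rewrite near_eq0_metric// (nbhs_singleton f0) mul0r addr0.
rewrite integral_mkcond.
transitivity (\int[lebesgue_tuple m]_t
    \sum_i (partial i (Y i) (row_of_tuple t))%:E)%E.
  apply: eq_integral => t _; rewrite patchE sumEFin; case: ifPn.
    rewrite inE /= => ct; set u := row_of_tuple t in ct *.
    have cx := chart_inv_dom ct.
    rewrite -(lapE cx) -{4}(chart_invK ct) divergence_flux// chart_invK//.
    by congr EFin; apply: eq_bigr => i _; exact/near_eq_partial/Y_flux.
  rewrite notin_setE /= => nct; rewrite big1// => i _; apply: dY_far.
  by rewrite ltNge; apply/negP => /box_cod.
by rewrite integral_sum// big1.
Qed.

End local_green.

(** * Bump functions of class C^1 *)

Section bumps.
Context {R : realType}.

(** The square smooths the corner of the positive part just enough: the derivative [2 * Num.max 0 s]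
    is continuous. *)
Definition sqr_pos (s : R) : R := Num.max 0 s ^+ 2.

Lemma sqr_pos_derive (s : R) : is_derive s 1 sqr_pos (2 * Num.max 0 s).
Proof.
have [s0|s0|->] := ltgtP s 0.
- apply: (@near_eq_is_derive _ _ _ (cst 0)).
    have : \forall x \near s, x < 0.
      by apply: open_nbhs_nbhs; split=> //; exact: open_lt.
    by apply: filterS => x x0; rewrite /sqr_pos max_l ?expr0n// ltW.
  by rewrite mulr0; exact: is_derive_cst.
- apply: (@near_eq_is_derive R R R (fun x : R => x ^+ 2)).
    have : \forall x \near s, 0 < x.
      by apply: open_nbhs_nbhs; split=> //; exact: open_gt.
    by apply: filterS => x x0; rewrite /sqr_pos max_r// ltW.
  apply: is_derive_eq.
  by rewrite /GRing.scale /= mulr1 mulr_natl mulr2n.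
- rewrite ?maxxx mulr0.
  (* At 0 the difference quotient is the square of max(0, h) divided by [h], of absolute value at
     most [|h|]. *)
  have H : (fun h : R => h^-1 *: ((sqr_pos \o shift 0) (h *: 1) - sqr_pos 0))
      @ 0^' --> (0 : R).
    apply/cvgr0Pnorm_le => e e0; near=> h.
    have h0 : h != 0 by near: h; exact: nbhs_dnbhs_neq.
    rewrite /sqr_pos /= addr0 maxxx expr0n subr0 [h%:A]mulr1.
    rewrite /GRing.scale /= normrM normfV ler_pdivrMl ?normr_gt0//.
    have he : `|h| <= e by near: h; exact: dnbhs0_le.
    rewrite normrX expr2; apply: (@le_trans _ _ (`|h| * `|h|)).
      have : `|Num.max 0 h| <= `|h| by case: (leP 0 h); rewrite ?normr0.
      by move=> H; rewrite ler_pM.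
    by rewrite ler_wpM2l.
  by split; [apply/cvg_ex; exists 0|apply/cvg_lim].
Unshelve. all: by end_near. Qed.

Lemma sqr_pos_ge0 s : 0 <= sqr_pos s.
Proof. exact: sqr_ge0. Qed.

Lemma C1_at_sqr_pos m (f : 'rV[R]_m -> R) u : C1_at f u ->
  C1_at (sqr_pos \o f) u.
Proof.
move=> C1f; apply: C1_at_comp1 => //; near=> y.
have dE : derive1 sqr_pos = (fun s : R => 2 * Num.max 0 s).
  by apply/funext => s; rewrite derive1E; have [_] := sqr_pos_derive s.
split; first by case: (sqr_pos_derive y).
rewrite dE; apply: (@continuousM R R (cst 2) (fun s : R => Num.max 0 s)).
  exact: cst_continuous.
by apply: continuous_max; [exact: cst_continuous|exact: id].
Unshelve. all: by end_near. Qed.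

Variable m : nat.

(** The norm on rows is the maximum norm, so for [r > 0] this product over the coordinates is
    positive exactly where [|u - p| < r]. *)
Definition bump (p : 'rV[R]_m) (r : R) (u : 'rV[R]_m) : R :=
  \prod_i sqr_pos (r ^+ 2 - (u 0 i - p 0 i) ^+ 2).

Lemma bump_ge0 p r u : 0 <= bump p r u.
Proof. by apply: prodr_ge0 => i _; exact: sqr_pos_ge0. Qed.

Lemma bump_center p r : 0 < r -> 0 < bump p r p.
Proof.
move=> r0; apply: prodr_gt0 => i _; rewrite subrr expr0n subr0 /sqr_pos.
by rewrite exprn_gt0// lt_max exprn_gt0// orbT.
Qed.

Lemma bump_supp p r u : 0 <= r -> bump p r u != 0 -> closed_box p r u.
Proof.
move=> r0 /prodf_neq0 H; apply: mx_norm_le => // i.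
have := H i isT; rewrite /sqr_pos expf_eq0/= !mxE.
case: (leP (r ^+ 2 - (u 0 i - p 0 i) ^+ 2) 0) => [_|]; first by rewrite eqxx.
rewrite subr_gt0 => /ltW + _; rewrite -(@ler_sqr _ `|_|) ?nnegrE//.
by rewrite real_normK// num_real.
Qed.

Lemma bump_C1 p r u : C1_at (bump p r) u.
Proof.
apply: C1_at_prod => i.
apply: (@C1_at_sqr_pos m (fun w => r ^+ 2 - (w 0 i - p 0 i) ^+ 2)).
have C1i : C1_at (fun w : 'rV[R]_m => w 0 i - p 0 i) u.
  exact: C1_atD (C1_at_coord _ _) (C1_at_cst _ _).
have := C1_atD (C1_at_cst (r ^+ 2) u) (C1_atZ (-1) (C1_atM C1i C1i)).
by congr C1_at; apply/funext => w /=; rewrite mulN1r expr2.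
Qed.

End bumps.

Section chart_bumps.
Context {R : realType} {m : nat} {X : smoothManifold R m}.
Implicit Types (c : chart R m X).

Definition chart_bump c p r (x : X) : R :=
  if `[< chart_dom c x >] then bump p r (chart_map c x) else 0.

Lemma chart_bump_ge0 c p r x : 0 <= chart_bump c p r x.
Proof. by rewrite /chart_bump; case: asboolP => // _; exact: bump_ge0. Qed.

Lemma chart_bump_supp c p r x : 0 <= r -> chart_bump c p r x != 0 ->
  chart_dom c x /\ closed_box p r (chart_map c x).
Proof.
rewrite /chart_bump; case: asboolP; last by rewrite eqxx.
by move=> cx r0 /(bump_supp r0).
Qed.

Lemma chart_bump_center c r x : 0 < r -> chart_dom c x ->
  0 < chart_bump c (chart_map c x) r x.
Proof.
by rewrite /chart_bump; case: asboolP => // _ r0 _; exact: bump_center.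
Qed.

(** In the chart domain the function is a bump composed with a transition map. Elsewhere it vanishes
    on a neighbourhood: its support lies in the image of a closed box, which is compact and
    therefore closed. *)
Lemma chart_bump_C1 c p r : atlas c -> 0 <= r ->
  closed_box p r `<=` chart_cod c -> C1_fun (chart_bump c p r).
Proof.
move=> ac r0 box_cod d ad x dx.
have [cx|ncx] := pselect (chart_dom c x).
  apply: (@near_eq_C1_at _ _ (bump p r \o transition d c)).
    have := near_chart_inv dx (near_chart_dom cx).
    by apply: filterS => u cu /=; rewrite /chart_bump; case: asboolP.
  apply: C1_at_chain; last exact: bump_C1.
  by move=> j; exact: transition_C1.
apply: (@near_eq_C1_at _ _ (cst 0)); last exact: C1_at_cst.
have nKx : \forall y \near x, (~` (chart_inv c @` closed_box p r)) y.
  apply: open_nbhs_nbhs; split.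
    by apply: closed_openC; exact: closed_box_inv_closed.
  by move=> [u /box_cod cu ux]; apply: ncx; rewrite -ux; exact: chart_inv_dom.
apply: filterS (near_chart_inv dx nKx) => u nKu /=.
apply/esym/eqP/negPn/negP => /(chart_bump_supp r0)[cy yb].
by apply: nKu; exists (chart_map c (chart_inv d u)) => //; rewrite chart_mapK ?inE.
Qed.

Lemma exists_chart_box c x (P : set X) : chart_dom c x -> nbhs x P ->
  exists2 r, 0 < r & closed_box (chart_map c x) r `<=`
    [set u | chart_cod c u /\ P (chart_inv c u)].
Proof.
move=> cx Px.
have : nbhs (chart_map c x) [set u | chart_cod c u /\ P (chart_inv c u)].
  by apply: filterI; [exact: near_chart_cod|exact: near_chart_inv].
move=> /nbhs_ballP[e /= e0 eP].
exists (e / 2); first by rewrite divr_gt0.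
move=> u; rewrite /closed_box /= => ub; apply: eP.
rewrite mx_norm_ball /ball_ /= distrC (le_lt_trans ub)//.
by rewrite ltr_pdivrMr// ltr_pMr// ltr1n.
Qed.

End chart_bumps.

(** * Positivity of the Lebesgue measure of cubes *)

Section cubes.
Context {R : realType}.

Definition tuple_cube m (p : m.-tuple R) (K : R) : set (m.-tuple R) :=
  [set t | forall j, `|tnth t j - tnth p j| <= K].

Lemma lebesgue_tuple_cube_gt0 m (p : m.-tuple R) (K : R) : 0 < K ->
  measurable (tuple_cube p K) /\ (0 < lebesgue_tuple m (tuple_cube p K))%E.
Proof.
move=> K0; elim: m p => [|m IH] p.
  have -> : tuple_cube p K = setT by apply/seteqP; split=> // t _ [].
  by split=> //=; rewrite diracT.
case/tupleP: p => x p; have [mc c0] := IH p.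
have mC : measurable (tuple_cube [tuple of x :: p] K).
  have -> : tuple_cube [tuple of x :: p] K = \bigcap_(j in [set: 'I_m.+1])
    (fun t : m.+1.-tuple R => tnth t j) @^-1`
      `[tnth [tuple of x :: p] j - K, tnth [tuple of x :: p] j + K].
    apply/seteqP; split=> t /= H j.
      by move=> _ /=; rewrite in_itv/= -ler_distl.
    by have := H j I; rewrite /= in_itv/= -ler_distl.
  apply: fin_bigcap_measurable => // j _.
  by rewrite -[X in measurable X]setTI; apply: measurable_tnth.
split=> //=; rewrite /lebesgue_step /pushforward.
have -> : @tuple_cons R m @^-1` tuple_cube [tuple of x :: p] K =
    `[x - K, x + K] `*` tuple_cube p K.
  apply/seteqP; split=> -[y t] /=.
    move=> H; split => /=; first by have := H ord0; rewrite in_itv/= -ler_distl.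
    by move=> j; have := H (lift ord0 j); rewrite tuple_consS tnthS.
  move=> [yK tK] j; case: (unliftP ord0 j) => [j'|] ->.
    by rewrite tuple_consS tnthS; exact: tK.
  by move: yK; rewrite /= in_itv/= -ler_distl.
rewrite product_measure1E//; apply: mule_gt0 => //.
have /= := lebesgue_measure_itv `[x - K, x + K].
move=> /(congr1 (fun z => 0 < z)%E) ->.
by rewrite lte_fin ifT -?EFinB ?lte_fin; lra.
Qed.

End cubes.

(** * Integration and Green's formula on a closed manifold *)

Section closed_manifold.
Context {R : realType} {m : nat} {X : smoothManifold R m}.
Hypothesis closedX : compact [set: X].
Variables (G : riemannianMetric X) (vol : {measure set (borel X) -> \bar R}).
Hypothesis volG : riemannian_volume G vol.

Local Notation center x := (chart_map (chart_of x) x).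

Lemma row_box_cube (p : 'rV[R]_m) (r : R) : 0 < r ->
  @row_of_tuple R m @^-1` closed_box p r = tuple_cube (tuple_of_row p) r.
Proof.
move=> r0; apply/seteqP; split=> t /=.
  move=> tp j; rewrite tnth_mktuple; apply: le_trans tp.
  by have := mx_norm_coord (row_of_tuple t - p) j; rewrite !mxE.
move=> H; apply: mx_norm_le => [|j]; first exact: ltW.
by have := H j; rewrite tnth_mktuple !mxE.
Qed.

Lemma row_box_lty (p : 'rV[R]_m) (r : R) : 0 < r ->
  (lebesgue_tuple m (@row_of_tuple R m @^-1` closed_box p r) < +oo)%E.
Proof.
move=> r0; apply: le_lt_trans (lebesgue_tuple_box_lty m (`|p| + r)).
apply: le_measure; rewrite ?inE.
- by rewrite row_box_cube//; have [] := lebesgue_tuple_cube_gt0 (tuple_of_row p) r0.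
- exact: measurable_tuple_box.
- move=> t /= tp j; have := mx_norm_coord (row_of_tuple t) j; rewrite mxE => tj.
  have := ler_normD (row_of_tuple t - p) p; rewrite subrK => tp'.
  rewrite /closed_box /= in tp; lra.
Qed.

Section chart_box.
Variables (c : chart R m X) (p : 'rV[R]_m) (r : R).
Hypotheses (ac : atlas c) (r0 : 0 < r) (box_cod : closed_box p r `<=` chart_cod c).

Local Notation B := (@row_of_tuple R m @^-1` closed_box p r).

Lemma row_box_measurable : measurable B.
Proof.
by rewrite row_box_cube//; have [] := lebesgue_tuple_cube_gt0 (tuple_of_row p) r0.
Qed.

Lemma box_nonempty : closed_box p r !=set0.
Proof. by exists p; rewrite /closed_box /= subrr normr0 ltW. Qed.

Lemma box_continuous (f : 'rV[R]_m -> R) : {in chart_cod c, continuous f} ->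
  {within closed_box p r, continuous f}.
Proof.
move=> cf; apply: continuous_in_subspaceT => u; rewrite inE => /box_cod cu.
by apply: cf; rewrite inE.
Qed.

Lemma inv_box_measurable :
  measurable (chart_inv c @` closed_box p r : set (borel X)).
Proof.
rewrite -[X in measurable X]setCK; apply: measurableC.
by apply: open_measurable_borel; apply: closed_openC; exact: closed_box_inv_closed.
Qed.

(** The density is continuous, hence bounded on the compact box, and the box has finite Lebesgue
    measure. *)
Lemma volume_box_lty : (vol (chart_inv c @` closed_box p r) < +oo)%E.
Proof.
have [u0 _ Hu0] : exists2 u0, u0 \in closed_box p r &
    forall u, u \in closed_box p r -> sqrt_det G c u <= sqrt_det G c u0.
  apply: compact_EVT_max.
  - exact: box_nonempty.
  - exact: closed_box_compact.
  - apply: box_continuous => u /set_mem cu.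
    by apply: C1_at_continuous; exact: sqrt_det_C1_at.
have sub : chart_inv c @` closed_box p r `<=` chart_dom c.
  by move=> _ [u /box_cod cu <-]; exact: chart_inv_dom.
rewrite -[X in vol X](setIidl sub) (volume_chart volG ac inv_box_measurable).
apply: (@le_lt_trans _ _ (\int[lebesgue_tuple m]_(t in B)
    (cst (sqrt_det G c u0)%:E) t)%E).
  have -> : (\int[lebesgue_tuple m]_(t in @row_of_tuple R m @^-1` chart_cod c)
    (\1_(chart_inv c @` closed_box p r) (chart_inv c (row_of_tuple t)) *
       sqrt_det G c (row_of_tuple t))%:E =
    \int[lebesgue_tuple m]_(t in B) (sqrt_det G c (row_of_tuple t))%:E)%E.
    rewrite integral_mkcond [RHS]integral_mkcond; apply: eq_integral => t _.
    rewrite !patchE; case: ifPn => [|nct]; rewrite ?inE/=.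
      move=> ct; rewrite indicE; case: ifPn.
        rewrite inE /= => bt; rewrite mem_set ?mul1r//=.
        by exists (row_of_tuple t).
      rewrite notin_setE /= => nbt; rewrite memNset ?mul0r//=.
      move=> [u bu /(congr1 (chart_map c))]; rewrite !chart_invK//; last exact: box_cod.
      by move=> ut; apply: nbt; rewrite -ut.
    rewrite ifF//; apply/negP; rewrite inE /= => /box_cod.
    by move: nct; rewrite notin_setE.
  apply: ge0_le_integral => //=.
  - exact: row_box_measurable.
  - by move=> t _; rewrite lee_fin sqrtr_ge0.
  - apply/measurable_EFinP; apply: measurable_funS (density_measurable G ac).
      exact: chart_cod_measurable.
    by move=> t /box_cod.
  - by move=> t bt; rewrite lee_fin Hu0// inE.
rewrite integral_cst; last exact: row_box_measurable.
rewrite lte_mul_pinfty ?lee_fin ?sqrtr_ge0//; exact: row_box_lty.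
Qed.

End chart_box.

(** By compactness, finitely many of the open sets where a chart bump is positive cover [X]. This
    serves twice: the boxes bound the volume, and the sum of the bumps has no zero and can be
    divided by. *)
Lemma finite_chart_boxes : exists (D : seq X) (r : X -> R),
  (forall x, 0 < r x /\ closed_box (center x) (r x) `<=` chart_cod (chart_of x)) /\
  forall y, exists2 x, x \in D & 0 < chart_bump (chart_of x) (center x) (r x) y.
Proof.
have /choice[r rP] : forall x : X, exists r, 0 < r /\
    closed_box (center x) r `<=` chart_cod (chart_of x).
  move=> x; have [r r0 H] := exists_chart_box (chart_of_dom x) (@filterT _ (nbhs x) _).
  by exists r; split=> // u /H[].
have := closedX; rewrite compact_cover.
move=> /(_ X setT (fun x => [set y | 0 < chart_bump (chart_of x) (center x) (r x) y])).
case.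
- move=> x _; have [r0 box_cod] := rP x.
  have cb := C1_fun_continuous
    (chart_bump_C1 (chart_of_atlas x) (ltW r0) box_cod).
  have -> : [set y | 0 < chart_bump (chart_of x) (center x) (r x) y] =
    chart_bump (chart_of x) (center x) (r x) @^-1` [set s | 0 < s] by [].
  by apply: open_comp => [y _|]; [exact: cb|exact: open_gt].
- move=> x _; exists x => //=; have [r0 _] := rP x.
  by apply: chart_bump_center => //; exact: chart_of_dom.
move=> D _ DP; exists (finmap.enum_fset D), r; split=> // y.
by have [x xD xy] := DP y I; exists x.
Qed.

Lemma volume_lty : (vol setT < +oo)%E.
Proof.
have [D [r [rP DP]]] := finite_chart_boxes.
pose K x := chart_inv (chart_of x) @` closed_box (center x) (r x).
have mK x : measurable (K x : set (borel X)).
  by have [r0 bc] := rP x; exact: inv_box_measurable.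
have KX : [set: X] `<=` \bigcup_(x in [set` D]) K x.
  move=> y _; have [x xD xy] := DP y; exists x => //.
  have [r0 _] := rP x; have := lt0r_neq0 xy.
  move=> /(chart_bump_supp (ltW r0))[cy yb].
  by exists (chart_map (chart_of x) y) => //; rewrite chart_mapK ?inE.
apply: (@le_lt_trans _ _ (\sum_(x \in [set` D]) vol (K x))%E).
  apply: (@content_sub_fsum _ _ _ vol X [set` D] setT K) => //; exact: finite_seq.
rewrite fsbig_finite/=; last exact: finite_seq.
apply: lte_sum_pinfty => x _; have [r0 bc] := rP x.
by apply: volume_box_lty => //; exact: chart_of_atlas.
Qed.

Lemma continuous_integrable (f : X -> R) : continuous f ->
  vol.-integrable setT (EFin \o (f : borel X -> R)).
Proof.
move=> cf.
have /compact_bounded[M [_ HM]] : compact (f @` [set: X]).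
  by apply: continuous_compact => //; exact: continuous_subspaceT.
apply: (@integrable_bounded_support _ _ _ _ setT _ (`|M| + 1)) => //.
- exact: volume_lty.
- exact: continuous_borel_measurable.
- by move=> x; apply: HM; [rewrite ltr_pwDr// ler_norm|exists x].
- by move=> x /(_ I).
Qed.

(** Around a point where [f] is positive there is a closed box on which [f] times the density has a
    positive minimum; the box has positive Lebesgue measure, so the integral would be positive. *)
Lemma integral_eq0_continuous (f : X -> R) : continuous f ->
  (forall x, 0 <= f x) -> (\int[vol]_x (f x)%:E = 0)%E -> forall x, f x = 0.
Proof.
move=> cf f0 intf0 x; apply/eqP/negPn/negP => fx.
set c := chart_of x; have ac : atlas c := chart_of_atlas x.
have cx : chart_dom c x := chart_of_dom x.
have fx0 : \forall y \near x, 0 < f y.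
  have : nbhs (f x) [set s | 0 < s].
    by apply: open_nbhs_nbhs; split; [exact: open_gt|rewrite /= lt_def fx f0].
  exact: cf.
have [r r0 box] := exists_chart_box cx fx0.
have box_cod : closed_box (chart_map c x) r `<=` chart_cod c by move=> u /box[].
pose B := @row_of_tuple R m @^-1` closed_box (chart_map c x) r.
have mB : measurable B by exact: row_box_measurable.
pose g u := f (chart_inv c u) * sqrt_det G c u.
have [u0 /set_mem bu0 Hu0] : exists2 u0, u0 \in closed_box (chart_map c x) r &
    forall u, u \in closed_box (chart_map c x) r -> g u0 <= g u.
  apply: compact_EVT_min.
  - exact: box_nonempty.
  - exact: closed_box_compact.
  - apply: (box_continuous box_cod) => u /set_mem cu; apply: continuousM.
      apply: continuous_comp; last exact: cf.
      exact: chart_inv_continuous (mem_set cu).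
    by apply: C1_at_continuous; exact: sqrt_det_C1_at.
have gu0 : 0 < g u0.
  by have [cu fu] := box _ bu0; apply: mulr_gt0 => //; exact: sqrt_det_gt0.
have mf : measurable_fun setT (EFin \o (f : borel X -> R)).
  by apply/measurable_EFinP; exact: continuous_borel_measurable.
have mcod := chart_cod_measurable c.
have mg : measurable_fun (@row_of_tuple R m @^-1` chart_cod c)
    (fun t => (g (row_of_tuple t))%:E).
  apply/measurable_EFinP; apply: measurable_funM; last exact: density_measurable.
  apply: (@measurableT_comp _ _ _ _ _ _ (f : borel X -> R)).
    exact: continuous_borel_measurable.
  exact: chart_inv_measurable.
have g0 t : (0 <= (g (row_of_tuple t))%:E)%E.
  by rewrite lee_fin mulr_ge0// sqrtr_ge0.
have : ((g u0)%:E * lebesgue_tuple m B <= \int[vol]_x (f x)%:E)%E.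
  rewrite -integral_cst//.
  apply: (@le_trans _ _ (\int[lebesgue_tuple m]_(t in B) (g (row_of_tuple t))%:E)%E).
    apply: ge0_le_integral => //=.
    - by move=> t _; rewrite lee_fin ltW.
    - by apply: measurable_funS mg => // t /box_cod.
    - by move=> t bt; rewrite lee_fin Hu0// inE.
  apply: (@le_trans _ _ (\int[lebesgue_tuple m]_(t in @row_of_tuple R m @^-1` chart_cod c)
      (g (row_of_tuple t))%:E)%E).
    by apply: ge0_subset_integral => // t /box_cod.
  rewrite -(chart_integral_ge0 volG ac (F := EFin \o f)) //=.
  - apply: ge0_subset_integral => //; first exact: chart_dom_measurable.
    by move=> y _; rewrite lee_fin.
  - exact: measurable_funTS.
rewrite intf0 leNgt mule_gt0//.
rewrite /B row_box_cube//.
by have [] := lebesgue_tuple_cube_gt0 (tuple_of_row (chart_map c x)) r0.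
Qed.

Lemma green (f v l : X -> R) : C1_fun f -> smooth_fun v -> continuous l ->
    (forall c, atlas c -> forall x, chart_dom c x -> laplacian G c v x = l x) ->
  (\int[vol]_x (f x * l x + metric G f v x)%:E = 0)%E.
Proof.
move=> C1f sv cl lapE; have C1v := smooth_C1_fun sv.
have [D [r [rP DP]]] := finite_chart_boxes.
pose rho x := chart_bump (chart_of x) (center x) (r x).
have C1rho x : C1_fun (rho x).
  by have [r0 bc] := rP x; apply: chart_bump_C1 => //; [exact: chart_of_atlas|exact: ltW].
pose S y := \sum_(x <- D) rho x y.
have C1S : C1_fun S by exact: C1_fun_sum.
have S0 y : S y != 0.
  have [x xD xy] := DP y; rewrite gt_eqF// /S (big_rem x)//=.
  by rewrite ltr_pwDl// sumr_ge0// => z _; exact: chart_bump_ge0.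
(* Dividing [f] once by the sum of the bumps replaces normalizing each bump: [f] is the sum of the
   functions [rho x \* w], each supported in one box. *)
have [w C1w wE] : exists2 w, C1_fun w & forall y, w y = f y / S y.
  by exists (f \* (fun y => (S y)^-1)) => //; exact: (C1_funM C1f (C1_funV S0 C1S)).
have C1rw x : C1_fun (rho x \* w) := C1_funM (C1rho x) C1w.
have fE : f = fun y => \sum_(x <- D) (rho x \* w) y.
  apply/funext => y; rewrite -big_distrl /= -/(S y) wE mulrC divfK//.
have metric_sum s y : metric G (fun z => \sum_(x <- s) (rho x \* w) z) v y =
    \sum_(x <- s) metric G (rho x \* w) v y.
  elim: s => [|x s IH].
    by rewrite big_nil; under eq_fun do rewrite big_nil; exact: metric_cstl.
  rewrite big_cons -IH -(metricDl _ _ _ (C1rw x) (C1_fun_sum s C1rw)).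
  by congr (metric G _ v y); apply/funext => z; rewrite big_cons.
have metricE' y : metric G f v y = \sum_(x <- D) metric G (rho x \* w) v y.
  by rewrite {1}fE metric_sum.
under eq_integral => y _.
  rewrite metricE' [f y](congr1 (@^~ y) fE) big_distrl -big_split /= -sumEFin.
  over.
rewrite integral_sum//.
- rewrite big1_seq// => x _; have [r0 bc] := rP x.
  apply: (local_green volG (chart_of_atlas x) (C1rw x) sv cl _ bc) => //.
    move=> y; rewrite /= mulf_eq0 negb_or => /andP[rxy _].
    by apply: chart_bump_supp rxy; exact: ltW.
  by apply: lapE; exact: chart_of_atlas.
- move=> x; apply: continuous_integrable => y.
  apply: (@continuousD _ _ _ ((rho x \* w) \* l) (metric G (rho x \* w) v)).
    by apply: continuousM; [exact: C1_fun_continuous (C1rw x) y|exact: cl].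
  exact: metric_continuous.
Qed.

End closed_manifold.

(** * The algebra of eigenfamilies *)

Section complex_parts.
Context {R : rcfType}.
Implicit Types x y : R[i].

Lemma complex_ReM x y : complex.Re (x * y) =
  complex.Re x * complex.Re y - complex.Im x * complex.Im y.
Proof. by case: x y => [a b] [c d]. Qed.

Lemma complex_ImM x y : complex.Im (x * y) =
  complex.Re x * complex.Im y + complex.Im x * complex.Re y.
Proof. by case: x y => [a b] [c d]. Qed.

Lemma complex_ReD x y : complex.Re (x + y) = complex.Re x + complex.Re y.
Proof. by case: x y => [a b] [c d]. Qed.

Lemma complex_ImD x y : complex.Im (x + y) = complex.Im x + complex.Im y.
Proof. by case: x y => [a b] [c d]. Qed.

Lemma complex_eqP x y :
  complex.Re x = complex.Re y -> complex.Im x = complex.Im y -> x = y.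
Proof. by case: x y => [a b] [c d] /= -> ->. Qed.

Lemma conjcD x y : conjc (x + y) = conjc x + conjc y.
Proof. exact: (rmorphD conjc). Qed.

Lemma conjcM x y : conjc (x * y) = conjc x * conjc y.
Proof. exact: (rmorphM conjc). Qed.

Lemma Re_conj x : complex.Re (conjc x) = complex.Re x. Proof. by case: x. Qed.

Lemma Im_conj x : complex.Im (conjc x) = - complex.Im x. Proof. by case: x. Qed.

End complex_parts.

(* An algebra [A] of functions carrying a positive carre du champ [Gam], and an
   integral [I] on a larger algebra [B].  The Laplacian appears only weakly, as
   the adjoint of [Gam], so that products of family members need no second
   derivatives. *)
Section eigenfamily_calculus.
Context {R : rcfType} {T J : Type}.
Variables (A B : (T -> R) -> Prop) (Gam : (T -> R) -> (T -> R) -> T -> R)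
  (I : (T -> R) -> R).
Implicit Types (f g h w : T -> R) (F H K W : T -> R[i]) (s t : seq J).
Hypotheses (A_cst : forall a, A (fun=> a))
  (AD : forall f g, A f -> A g -> A (fun x => f x + g x))
  (AM : forall f g, A f -> A g -> A (fun x => f x * g x))
  (AB : forall f, A f -> B f)
  (BD : forall f g, B f -> B g -> B (fun x => f x + g x))
  (BM : forall f g, B f -> B g -> B (fun x => f x * g x)).
Hypotheses (BGam : forall f g, A f -> A g -> B (Gam f g))
  (Gam_sym : forall f g x, Gam f g x = Gam g f x)
  (GamD : forall f g h x, A f -> A g ->
    Gam (fun y => f y + g y) h x = Gam f h x + Gam g h x)
  (GamM : forall f g h x, A f -> A g ->
    Gam (fun y => f y * g y) h x = f x * Gam g h x + g x * Gam f h x)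
  (Gam_cst : forall a h x, Gam (fun=> a) h x = 0)
  (Gam_ge0 : forall f x, 0 <= Gam f f x)
  (Gam_eq0 : forall f g x, Gam f f x = 0 -> Gam f g x = 0).
Hypotheses
  (ID : forall f g, B f -> B g -> I (fun x => f x + g x) = I f + I g)
  (IZ : forall a f, B f -> I (fun x => a * f x) = a * I f)
  (I_eq0 : forall f, B f -> (forall x, 0 <= f x) -> I f = 0 -> forall x, f x = 0).

Let re F x := complex.Re (F x).
Let im F x := complex.Im (F x).

Let AN f : A f -> A (fun x => - f x).
Proof.
move=> Af; have := AM (A_cst (-1)) Af.
by congr A; apply/funext => x; rewrite mulN1r.
Qed.

Let BN f : B f -> B (fun x => - f x).
Proof.
move=> Bf; have := BM (AB (A_cst (-1))) Bf.
by congr B; apply/funext => x; rewrite mulN1r.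
Qed.

Let IN f : B f -> I (fun x => - f x) = - I f.
Proof.
move=> Bf; rewrite -mulN1r -IZ//; congr I.
by apply/funext => x; rewrite mulN1r.
Qed.

Let GamN f h x : A f -> Gam (fun y => - f y) h x = - Gam f h x.
Proof.
move=> Af; have := GamM h x (A_cst (-1)) Af.
rewrite Gam_cst mulr0 addr0 mulN1r => <-.
by congr (Gam _ h x); apply/funext => y; rewrite mulN1r.
Qed.

Definition complexified (P : (T -> R) -> Prop) F : Prop := P (re F) /\ P (im F).

Let AC := complexified A.
Let BC := complexified B.

Let ACB F : AC F -> BC F. Proof. by case=> *; split; exact: AB. Qed.

Let ACM F H : AC F -> AC H -> AC (fun x => F x * H x).
Proof.
move=> [A1 A2] [A3 A4]; split.
  rewrite (_ : re _ = fun x => re F x * re H x + - (im F x * im H x)).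
    exact: AD (AM A1 A3) (AN (AM A2 A4)).
  by apply/funext => x; exact: complex_ReM.
rewrite (_ : im _ = fun x => re F x * im H x + im F x * re H x).
  exact: AD (AM A1 A4) (AM A2 A3).
by apply/funext => x; exact: complex_ImM.
Qed.

Let BCM F H : BC F -> BC H -> BC (fun x => F x * H x).
Proof.
move=> [A1 A2] [A3 A4]; split.
  rewrite (_ : re _ = fun x => re F x * re H x + - (im F x * im H x)).
    exact: BD (BM A1 A3) (BN (BM A2 A4)).
  by apply/funext => x; exact: complex_ReM.
rewrite (_ : im _ = fun x => re F x * im H x + im F x * re H x).
  exact: BD (BM A1 A4) (BM A2 A3).
by apply/funext => x; exact: complex_ImM.
Qed.

Let BCD F H : BC F -> BC H -> BC (fun x => F x + H x).
Proof.
move=> [A1 A2] [A3 A4]; split.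
  rewrite (_ : re _ = fun x => re F x + re H x); first exact: BD.
  by apply/funext => x; exact: complex_ReD.
rewrite (_ : im _ = fun x => im F x + im H x); first exact: BD.
by apply/funext => x; exact: complex_ImD.
Qed.

Let ACconj F : AC F -> AC (fun x => conjc (F x)).
Proof.
move=> [A1 A2]; split.
  by rewrite (_ : re _ = re F) //; apply/funext => x; exact: Re_conj.
rewrite (_ : im _ = fun x => - im F x); first exact: AN.
by apply/funext => x; exact: Im_conj.
Qed.

Let AC_cst z : AC (fun=> z). Proof. by split; exact: A_cst. Qed.

(** The complex-bilinear extension of [Gam], without conjugation: it is the right-hand side of
    [kappaE]. *)
Definition cGam F H x : R[i] :=
  (Gam (re F) (re H) x - Gam (im F) (im H) x) +i*
  (Gam (re F) (im H) x + Gam (im F) (re H) x).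

Definition cI F : R[i] := I (re F) +i* I (im F).

Let BCcGam F H : AC F -> AC H -> BC (cGam F H).
Proof.
move=> [A1 A2] [A3 A4]; split.
  exact: BD (BGam A1 A3) (BN (BGam A2 A4)).
exact: BD (BGam A1 A4) (BGam A2 A3).
Qed.

Let cGam_sym F H x : cGam F H x = cGam H F x.
Proof.
rewrite /cGam (Gam_sym (re F) (re H)) (Gam_sym (im F) (im H)).
rewrite (Gam_sym (re F) (im H)) (Gam_sym (im F) (re H)).
by rewrite [X in _ +i* X]addrC.
Qed.

Let cGamM F H K x : AC F -> AC H ->
  cGam (fun y => F y * H y) K x = F x * cGam H K x + H x * cGam F K x.
Proof.
move=> [A1 A2] [A3 A4].
have E1 k : Gam (re (fun y => F y * H y)) k x =
    re F x * Gam (re H) k x + re H x * Gam (re F) k x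
    - (im F x * Gam (im H) k x + im H x * Gam (im F) k x).
  rewrite -(GamM k x A1 A3) -(GamM k x A2 A4) -(GamN _ _ (AM A2 A4)).
  rewrite -(GamD _ _ (AM A1 A3) (AN (AM A2 A4))).
  by congr (Gam _ k x); apply/funext => y; exact: complex_ReM.
have E2 k : Gam (im (fun y => F y * H y)) k x =
    re F x * Gam (im H) k x + im H x * Gam (re F) k x
    + (im F x * Gam (re H) k x + re H x * Gam (im F) k x).
  rewrite -(GamM k x A1 A4) -(GamM k x A2 A3).
  rewrite -(GamD _ _ (AM A1 A4) (AM A2 A3)).
  by congr (Gam _ k x); apply/funext => y; exact: complex_ImM.
rewrite /cGam !E1 !E2; apply: complex_eqP;
  rewrite /= ?complex_ReD ?complex_ImD ?complex_ReM ?complex_ImM /=.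
  by rewrite -/(re F x) -/(re H x) -/(im F x) -/(im H x); ring.
by rewrite -/(re F x) -/(re H x) -/(im F x) -/(im H x); ring.
Qed.

Let cGam_cst z K x : cGam (fun=> z) K x = 0.
Proof. by rewrite /cGam /re /im !Gam_cst subr0 addr0. Qed.

Let cGam_conj F H x : AC F -> AC H ->
  cGam (fun y => conjc (F y)) (fun y => conjc (H y)) x = conjc (cGam F H x).
Proof.
move=> [A1 A2] [A3 A4].
have rE K : re (fun y => conjc (K y)) = re K by apply/funext => y; exact: Re_conj.
have iE K : im (fun y => conjc (K y)) = fun y => - im K y.
  by apply/funext => y; exact: Im_conj.
rewrite /cGam !rE !iE !(GamN _ _ A2).
rewrite !(Gam_sym _ (fun y => - im H y)) !(GamN _ _ A4).
rewrite (Gam_sym (im H)) (Gam_sym (im H)); apply: complex_eqP => /=; ring.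
Qed.

Let cID F H : BC F -> BC H -> cI (fun x => F x + H x) = cI F + cI H.
Proof.
move=> [A1 A2] [A3 A4]; rewrite /cI; apply: complex_eqP => /=.
  by rewrite -ID//; congr I; apply/funext => x; exact: complex_ReD.
by rewrite -ID//; congr I; apply/funext => x; exact: complex_ImD.
Qed.

Let cIZ z F : BC F -> cI (fun x => z * F x) = z * cI F.
Proof.
move=> [A1 A2]; rewrite /cI; apply: complex_eqP; rewrite ?complex_ReM ?complex_ImM /=.
  rewrite -!IZ// -IN -?ID//.
  - by congr I; apply/funext => x; exact: complex_ReM.
  - exact: BM (AB (A_cst _)) A1.
  - exact: BN (BM (AB (A_cst _)) A2).
  - exact: BM (AB (A_cst _)) A2.
rewrite -!IZ// -ID.
- by congr I; apply/funext => x; exact: complex_ImM.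
- exact: BM (AB (A_cst _)) A2.
- exact: BM (AB (A_cst _)) A1.
Qed.

Let cI_conj F : BC F -> cI (fun x => conjc (F x)) = conjc (cI F).
Proof.
move=> [A1 A2]; apply: complex_eqP => /=.
  by congr I; apply/funext => x; exact: Re_conj.
by rewrite -IN//; congr I; apply/funext => x; exact: Im_conj.
Qed.

(** * Products of members of the family and their eigenvalues *)

Variables (lam mu : R[i]) (phi : J -> T -> R[i]).
Hypotheses (phi_A : forall j, complexified A (phi j))
  (phi_re : forall j w, A w ->
    I (fun x => w x * complex.Re (lam * phi j x) +
      Gam w (fun y => complex.Re (phi j y)) x) = 0)
  (phi_im : forall j w, A w ->
    I (fun x => w x * complex.Im (lam * phi j x) +
      Gam w (fun y => complex.Im (phi j y)) x) = 0)
  (phi_mu : forall j k x, cGam (phi j) (phi k) x = mu * phi j x * phi k x)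
  (nondegenerate : ~ (lam = 0 /\ mu = 0)).

(** The equation Delta F = L F multiplied by a test function and integrated by parts. *)
Definition weak_eigen F (L : R[i]) : Prop :=
  forall W, AC W -> cI (fun x => W x * (L * F x) + cGam W F x) = 0.

(** The hypotheses concern real test functions. The real part of the claim is [phi_re] for the real
    part of [W] minus [phi_im] for its imaginary part; the imaginary part is the crossed sum. *)
Lemma weak_eigen_phi j : weak_eigen (phi j) lam.
Proof.
move=> W [W1 W2]; have [P1 P2] := phi_A j.
have Al : AC (fun x => lam * phi j x) := ACM (AC_cst lam) (phi_A j).
have [L1 L2] := Al.
have Bt w h f : A w -> A f -> A h -> B (fun x => w x * h x + Gam w f x).
  by move=> Aw Af Ah; exact: BD (BM (AB Aw) (AB Ah)) (BGam Aw Af).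
apply: complex_eqP => /=.
  rewrite -[RHS](subrr 0) -{1}(phi_re j W1) -(phi_im j W2).
  rewrite -IN; last exact: Bt W2 P2 L2.
  rewrite -ID; last 2 first.
  - exact: Bt W1 P1 L1.
  - exact: BN (Bt _ _ _ W2 P2 L2).
  by congr I; apply/funext => x; rewrite /cGam /re /im;
    rewrite complex_ReD (complex_ReM (W x)) /=; ring.
rewrite -[RHS](addr0 0) -{1}(phi_im j W1) -(phi_re j W2).
rewrite -ID; last 2 first.
- exact: Bt W1 P2 L2.
- exact: Bt W2 P1 L1.
by congr I; apply/funext => x; rewrite /cGam /re /im;
  rewrite complex_ImD (complex_ImM (W x)) /=; ring.
Qed.

Definition mono s x : R[i] := \prod_(j <- s) phi j x.

Let mono_cons j s : mono (j :: s) = fun x => phi j x * mono s x.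
Proof. by apply/funext => x; rewrite /mono big_cons. Qed.

Let mono_nil : mono [::] = fun=> 1.
Proof. by apply/funext => x; rewrite /mono big_nil. Qed.

Lemma mono_A s : AC (mono s).
Proof.
elim: s => [|j s IH]; first by rewrite mono_nil; exact: AC_cst.
by rewrite mono_cons; exact: ACM (phi_A j) IH.
Qed.

Lemma cGam_mono s j x :
  cGam (mono s) (phi j) x = (size s)%:R * mu * mono s x * phi j x.
Proof.
elim: s => [|k s IH]; first by rewrite mono_nil cGam_cst /= !mul0r.
rewrite mono_cons (cGamM _ _ (phi_A k) (mono_A s)).
by rewrite IH phi_mu /= -natr1; ring.
Qed.

(* The Laplace eigenvalue of a product of [d] members of the family. *)
Definition eigenvalue_deg (d : nat) : R[i] := d%:R * (lam + (d%:R - 1) * mu).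

(** Write F for the product of the [d] factors in [s]. The equation of F tested on [W * phi j] and
    that of [phi j] tested on [W * F] are added. By the Leibniz rule the gradient terms sum to
    [cGam] of [W] and [phi j * F], plus [2 * W * cGam (phi j) F]. The latter equals
    [2 * d * mu * W * phi j * F], so the eigenvalue grows by [lam + 2 * d * mu]. *)
Lemma weak_eigen_mono s : weak_eigen (mono s) (eigenvalue_deg (size s)).
Proof.
elim: s => [|j s IH] W AW.
  rewrite mono_nil /eigenvalue_deg /=.
  under eq_fun do rewrite cGam_sym cGam_cst !mul0r mulr0 addr0.
  by rewrite -[RHS](mul0r (cI (fun=> 0))) -cIZ ?mul0r//; exact/ACB/AC_cst.
have As := mono_A s.
have Aj := phi_A j.
have AWj := ACM AW Aj.
have AWs := ACM AW As.
have BL z F H : AC F -> AC H -> BC (fun x => F x * (z * H x) + cGam F H x).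
  move=> AF AH; apply: BCD; last exact: BCcGam.
  exact: BCM (ACB AF) (BCM (ACB (AC_cst z)) (ACB AH)).
have := congr2 +%R (IH _ AWj) (weak_eigen_phi j AWs).
rewrite addr0 -cID; [|exact: BL|exact: BL].
move=> E; rewrite -[RHS]E; congr cI; apply/funext => x.
rewrite mono_cons (cGam_sym W) (cGamM _ _ Aj As) (cGamM _ _ AW Aj) (cGamM _ _ AW As).
rewrite cGam_mono.
rewrite (cGam_sym (phi j) (mono s)) cGam_mono /eigenvalue_deg /= -natr1.
rewrite (cGam_sym W (mono s)) (cGam_sym W (phi j)).
ring.
Qed.

Definition mono_conj s t := fun x => mono s x * conjc (mono t x).

Let mono_conj_A s t : AC (mono_conj s t).
Proof. exact: ACM (mono_A s) (ACconj (mono_A t)). Qed.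

(** Testing the equation of [mono s] on the conjugate of [mono t], and conjugating the equation of
    [mono t] tested on the conjugate of [mono s], yields the same gradient term by symmetry; it
    cancels in the difference. *)
Lemma eigenvalue_mono_conj s t :
  (eigenvalue_deg (size s) - conjc (eigenvalue_deg (size t))) * cI (mono_conj s t) = 0.
Proof.
set a := eigenvalue_deg _; set b := eigenvalue_deg _.
have As := mono_A s; have At := mono_A t.
have BL z F H : AC F -> AC H -> BC (fun x => F x * (z * H x) + cGam F H x).
  move=> AF AH; apply: BCD; last exact: BCcGam.
  exact: BCM (ACB AF) (BCM (ACB (AC_cst z)) (ACB AH)).
have E1 := weak_eigen_mono s (ACconj At).
have := weak_eigen_mono t (ACconj As).
move=> /(congr1 conjc); rewrite conjc0 -cI_conj; last exact: BL (ACconj As) At.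
rewrite -/b => E2.
have K1 : BC (cGam (mono s) (fun x => conjc (mono t x))).
  exact: BCcGam As (ACconj At).
have Bp := ACB (mono_conj_A s t).
have Bz z : BC (fun x => z * mono_conj s t x) by exact: BCM (ACB (AC_cst z)) Bp.
have E1' : a * cI (mono_conj s t) + cI (cGam (mono s) (fun x => conjc (mono t x))) = 0.
  rewrite -E1 -cIZ// -cID//; congr cI; apply/funext => x.
  by rewrite cGam_sym /mono_conj -/a; congr (_ + _); ring.
have E2' : conjc b * cI (mono_conj s t) + cI (cGam (mono s) (fun x => conjc (mono t x))) = 0.
  rewrite -E2 -cIZ// -cID//; congr cI; apply/funext => x.
  have cc : cGam (mono s) (fun y => conjc (mono t y)) x =
      conjc (cGam (fun y => conjc (mono s y)) (mono t) x).
    rewrite -(cGam_conj x (ACconj As) At); congr (cGam _ _ x).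
    by apply/funext => y; rewrite conjcK.
  rewrite cc conjcD; congr (_ + _).
  by rewrite !conjcM conjcK /mono_conj; ring.
by rewrite mulrBl (addIr _ (etrans E1' (esym E2'))) subrr.
Qed.

Lemma cI_normsq_eq0 F x : AC F -> cI (fun y => F y * conjc (F y)) = 0 -> F x = 0.
Proof.
move=> [F1 F2] /(congr1 (@complex.Re R)) /= E.
have BF : B (fun y => re F y * re F y + im F y * im F y).
  by apply: BD (BM _ _) (BM _ _); exact: AB.
have E' : I (fun y => re F y * re F y + im F y * im F y) = 0.
  rewrite -E; congr I; apply/funext => y.
  by rewrite /re /im complex_ReM Re_conj Im_conj mulrN opprK.
have := I_eq0 BF _ E' x; rewrite -!expr2 => H.
have /eqP := H (fun y => addr_ge0 (sqr_ge0 _) (sqr_ge0 _)).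
rewrite paddr_eq0 ?sqr_ge0// !sqrf_eq0 => /andP[/eqP r0 /eqP i0].
exact: complex_eqP.
Qed.

Lemma mono_nseq k j x : mono (nseq k j) x = phi j x ^+ k.
Proof. by rewrite /mono big_nseq -Monoid.iteropE. Qed.

Lemma eigenvalue_real k j x : phi j x != 0 ->
  conjc (eigenvalue_deg k) = eigenvalue_deg k.
Proof.
move=> phi0; have := eigenvalue_mono_conj (nseq k j) (nseq k j).
rewrite size_nseq => /eqP; rewrite mulf_eq0 subr_eq0 => /orP[/eqP <-//|/eqP].
move=> /(cI_normsq_eq0 x (mono_A _)); rewrite mono_nseq => /eqP.
by rewrite expf_eq0 (negbTE phi0) andbF.
Qed.

Lemma eigenvalue_neq0 k j x : phi j x != 0 -> lam + k%:R * mu != 0.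
Proof.
move=> phi0; apply/negP => /eqP L0.
pose F := mono (nseq k.+1 j); have AF : AC F := mono_A _.
have [F1 F2] := AF.
(* The eigenvalue of F is [(k + 1) * (lam + k * mu) = 0], and the test function conj F turns the
   equation into the vanishing of the integral of |grad Re F|^2 + |grad Im F|^2. *)
have := weak_eigen_mono (nseq k.+1 j) (ACconj AF).
rewrite size_nseq /eigenvalue_deg -natr1 addrK L0 mulr0.
under eq_fun do rewrite mul0r mulr0 add0r.
move=> /(congr1 (@complex.Re R)) /= E.
have BF : B (fun y => Gam (re F) (re F) y + Gam (im F) (im F) y).
  exact: BD (BGam F1 F1) (BGam F2 F2).
have E' : I (fun y => Gam (re F) (re F) y + Gam (im F) (im F) y) = 0.
  rewrite -E; congr I; apply/funext => y; rewrite /cGam /= -/F.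
  rewrite (_ : re (fun z => conjc (F z)) = re F); last first.
    by apply/funext => z; exact: Re_conj.
  rewrite (_ : im (fun z => conjc (F z)) = fun z => - im F z); last first.
    by apply/funext => z; exact: Im_conj.
  by rewrite [RHS]/re /= (GamN _ _ F2) opprK.
have /eqP := I_eq0 BF (fun y => addr_ge0 (Gam_ge0 _ _) (Gam_ge0 _ _)) E' x.
rewrite paddr_eq0 ?Gam_ge0// => /andP[/eqP G1 /eqP G2].
(* As the gradient of F vanishes at [x], this reads [(k + 1) * mu * phi j x ^+ (k + 2) = 0], hence
   [mu = 0], and then [lam = 0]. *)
have := cGam_mono (nseq k.+1 j) j x; rewrite -/F.
rewrite /cGam !(Gam_eq0 _ G1) !(Gam_eq0 _ G2) subr0 addr0 => /esym/eqP.
rewrite /F size_nseq mono_nseq !mulf_eq0 expf_eq0 (negbTE phi0) andbF !orbF.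
rewrite pnatr_eq0 /= => /eqP mu0; apply: nondegenerate.
by move: L0; rewrite mu0 mulr0 addr0.
Qed.

Lemma cI_mono_conj_eq0 s t : size s != size t -> cI (mono_conj s t) = 0.
Proof.
move=> st.
(* The facts on eigenvalues require a nonzero value of some [phi j]. Without one every nonempty
   product is 0, and [s] or [t] is nonempty because their sizes differ. *)
have [[j [x phi0]]|phi0] := pselect (exists j x, phi j x != 0); last first.
  have mono0 j r x : mono (j :: r) x = 0.
    rewrite mono_cons; have [->|p0] := eqVneq (phi j x) 0; first by rewrite mul0r.
    by exfalso; apply: phi0; exists j, x.
  have -> : mono_conj s t = fun=> 0.
    apply/funext => x; rewrite /mono_conj; case: s t st => [|j s] [|k t]//= _.
    - by rewrite mono0 conjc0 mulr0.
    - by rewrite mono0 mul0r.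
    - by rewrite mono0 mul0r.
  by rewrite -[RHS](mul0r (cI (fun=> 0))) -cIZ ?mul0r//; exact/ACB/AC_cst.
have := eigenvalue_mono_conj s t; rewrite (eigenvalue_real _ phi0) => /eqP.
rewrite mulf_eq0 => /orP[|/eqP//]; move: st.
move: (size s) (size t) => d e de.
(* The difference of the eigenvalues of degrees [d] and [e] factors as
   [(d - e) * (lam + (d + e - 1) * mu)]. As [d] and [e] are distinct they are not both 0, so
   [d + e - 1] is a natural number [k]. *)
have [k kE] : exists k, (d + e = k.+1)%N.
  by case: d e de => [|d] [|e]//= _;
    [exists e|exists d; rewrite addn0|exists (d + e.+1)%N].
have -> : eigenvalue_deg d - eigenvalue_deg e = (d%:R - e%:R) * (lam + k%:R * mu).
  have -> : k%:R = d%:R + e%:R - 1 :> R[i] by rewrite -natrD kE -natr1 addrK.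
  by rewrite /eigenvalue_deg; ring.
rewrite mulf_eq0 (negbTE (eigenvalue_neq0 k phi0)) orbF subr_eq0 eqr_nat.
by rewrite (negbTE de).
Qed.

(* [P] and [P'] are exchanged by [phi j |-> z * phi j], up to integration
   against monomials in the [phi j] and their conjugates. *)
Definition rotates (z : R[i]) (P P' : T -> R[i]) : Prop :=
  [/\ BC P, BC P' & forall s t, cI (fun x => mono_conj s t x * P x) =
    z ^+ size s * conjc z ^+ size t * cI (fun x => mono_conj s t x * P' x)].

(** For sizes that agree the powers of [z] and of its conjugate multiply to 1; for sizes that differ
    both integrals vanish by [cI_mono_conj_eq0]. *)
Lemma rotates1 z : z * conjc z = 1 -> rotates z (fun=> 1) (fun=> 1).
Proof.
move=> z1; split; [exact/ACB/AC_cst|exact/ACB/AC_cst|move=> s t].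
have -> : (fun x => mono_conj s t x * 1) = mono_conj s t by apply/funext => x; rewrite mulr1.
have [->|st] := eqVneq (size s) (size t); first by rewrite -exprMn z1 expr1n mul1r.
by rewrite !cI_mono_conj_eq0// mulr0.
Qed.

(** Expanding the new factor lets [phi j] join the monomial of [s] and its conjugate that of [t];
    the hypothesis for these longer monomials then supplies the extra [z] or [conjc z]. This is why
    [rotates] quantifies over all monomials. *)
Lemma rotates_letter z j (a b : R[i]) P P' : rotates z P P' ->
  rotates z (fun x => (a * phi j x + b * conjc (phi j x)) * P x)
    (fun x => (a * z * phi j x + b * conjc z * conjc (phi j x)) * P' x).
Proof.
move=> [BP BP' HP].
have Bj := ACB (phi_A j); have Bjc := ACB (ACconj (phi_A j)).
have Bc c : BC (fun=> c) by exact/ACB/AC_cst.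
have Blin c d : BC (fun x => c * phi j x + d * conjc (phi j x)).
  exact: BCD (BCM (Bc c) Bj) (BCM (Bc d) Bjc).
split; [exact: BCM (Blin a b) BP|exact: BCM (Blin _ _) BP'|move=> s t].
have Bmono r q Q : BC Q -> BC (fun x => mono_conj r q x * Q x).
  by move=> BQ; exact: BCM (ACB (mono_conj_A r q)) BQ.
have lin c d Q : BC Q ->
    cI (fun x => mono_conj s t x * ((c * phi j x + d * conjc (phi j x)) * Q x)) =
    c * cI (fun x => mono_conj (j :: s) t x * Q x) +
    d * cI (fun x => mono_conj s (j :: t) x * Q x).
  move=> BQ.
  rewrite -(cIZ c (Bmono (j :: s) t _ BQ)) -(cIZ d (Bmono s (j :: t) _ BQ)).
  rewrite -cID; last 2 first.
  - exact: BCM (Bc c) (Bmono (j :: s) t _ BQ).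
  - exact: BCM (Bc d) (Bmono s (j :: t) _ BQ).
  congr cI; apply/funext => x; rewrite /mono_conj !mono_cons !conjcM; ring.
by rewrite !lin// !HP /= !exprS; ring.
Qed.

Definition negi : R[i] := 0 -i* 1.

(** Re phi = (phi + conj phi) / 2, and with z = - i the rotated factor is (- i phi + i conj phi) / 2
    = Im phi. *)
Lemma rotates_re j (P P' : T -> R) :
  rotates negi (fun x => (P x)%:C) (fun x => (P' x)%:C) ->
  rotates negi (fun x => (complex.Re (phi j x) * P x)%:C)
    (fun x => (complex.Im (phi j x) * P' x)%:C).
Proof.
move=> /(rotates_letter j (2^-1)%:C (2^-1)%:C).
by congr rotates; apply/funext => x; case: (phi j x) => u v;
  apply: complex_eqP => /=; field.
Qed.

(** Im phi = (- i phi + i conj phi) / 2, and with z = - i the rotated factor is - (phi + conj phi) /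
    2 = - Re phi. *)
Lemma rotates_im j (P P' : T -> R) :
  rotates negi (fun x => (P x)%:C) (fun x => (P' x)%:C) ->
  rotates negi (fun x => (complex.Im (phi j x) * P x)%:C)
    (fun x => (- complex.Re (phi j x) * P' x)%:C).
Proof.
move=> /(rotates_letter j (0 -i* 2^-1) (0 +i* 2^-1)).
by congr rotates; apply/funext => x; case: (phi j x) => u v;
  apply: complex_eqP => /=; field.
Qed.

Lemma integral_rotate (r : seq J) (a b : J -> nat) :
  I (fun x => \prod_(j <- r) (complex.Re (phi j x) ^+ a j *
                              complex.Im (phi j x) ^+ b j)) =
  I (fun x => \prod_(j <- r) (complex.Im (phi j x) ^+ a j *
                              (- complex.Re (phi j x)) ^+ b j)).
Proof.
set P := fun x : T => _; set P' := fun x : T => _.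
(* Only the empty monomials matter in the end: the powers of [negi] are then 1 and the plain
   integrals remain. *)
suff [_ _ /(_ [::] [::])] : rotates negi (fun x => (P x)%:C) (fun x => (P' x)%:C).
  rewrite /= !expr0 !mul1r => /(congr1 (@complex.Re R)) /=.
  have E Q : re (fun x => mono_conj [::] [::] x * (Q x)%:C) = Q.
    by apply/funext => x; rewrite /re /mono_conj mono_nil conjc1 !mul1r.
  by rewrite !E.
rewrite {}/P {}/P'; elim: r => [|j r IH].
  have E (Q : T -> J -> R) : (fun x => (\prod_(j <- [::]) Q x j)%:C) = fun=> 1.
    by apply/funext => x; rewrite big_nil.
  by rewrite !E; apply: rotates1; apply: complex_eqP => /=; ring.
under eq_fun do rewrite big_cons -mulrA.
under [X in rotates _ _ X]eq_fun do rewrite big_cons -mulrA.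
elim: (a j) => [|k IHk].
  under eq_fun do rewrite expr0 mul1r.
  under [X in rotates _ _ X]eq_fun do rewrite expr0 mul1r.
  elim: (b j) => [|k IHk].
    under eq_fun do rewrite expr0 mul1r.
    by under [X in rotates _ _ X]eq_fun do rewrite expr0 mul1r.
  under eq_fun do rewrite exprS -mulrA.
  under [X in rotates _ _ X]eq_fun do rewrite exprS -mulrA.
  exact: rotates_im IHk.
under eq_fun do rewrite exprS -mulrA.
under [X in rotates _ _ X]eq_fun do rewrite exprS -mulrA.
exact: rotates_re IHk.
Qed.

End eigenfamily_calculus.

(** * The two algebras realized by the C^1 and the continuous functions on a closed manifold *)

Theorem theorem8 (R : realType) (m : nat) (X : smoothManifold R m)
    (closedX : compact [set: X]) (G : riemannianMetric X)
    (vol : {measure set (borel X) -> \bar R}) (volG : riemannian_volume G vol)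
    (lam mu : R[i]) (nondegenerate : ~ (lam = 0 /\ mu = 0))
    (n : nat) (g h : 'I_n -> X -> R)
    (gh_eigenfamily : eigenfamily G lam mu
       [set (fun x => g j x +i* h j x) | j in [set: 'I_n]])
    (a b : 'I_n -> nat) :
  \int[vol]_x (\prod_(j < n) (g j x ^+ a j * h j x ^+ b j)) =
  (-1) ^+ (\sum_(j < n) b j)%N *
    \int[vol]_x (\prod_(j < n) (g j x ^+ b j * h j x ^+ a j)).
Proof.
pose phi j (x : X) : R[i] := g j x +i* h j x.
have phiF j : [set (fun x => g j x +i* h j x) | j in [set: 'I_n]] (phi j).
  by exists j.
have [sm lapE kapE] := gh_eigenfamily.
have sg j : smooth_fun (g j) by have [] := sm _ (phiF j).
have sh j : smooth_fun (h j) by have [] := sm _ (phiF j).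
have C1g j := smooth_C1_fun (sg j); have C1h j := smooth_C1_fun (sh j).
have cfun (f : X -> R) : C1_fun f -> continuous f by exact: C1_fun_continuous.
have intc (f : X -> R) : continuous f -> vol.-integrable setT (EFin \o f).
  exact: (continuous_integrable closedX volG).
have cM (f k : X -> R) : continuous f -> continuous k -> continuous (fun x => f x * k x).
  by move=> cf ck x; apply: continuousM; [exact: cf|exact: ck].
have cD (f k : X -> R) : continuous f -> continuous k -> continuous (fun x => f x + k x).
  by move=> cf ck x; apply: continuousD; [exact: cf|exact: ck].
have weak (f v l : X -> R) : C1_fun f -> smooth_fun v -> continuous l ->
    (forall c, atlas c -> forall x, chart_dom c x -> laplacian G c v x = l x) ->
    \int[vol]_x (f x * l x + metric G f v x) = 0.
  move=> C1f sv cl lv; rewrite /Rintegral.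
  by rewrite (green closedX volG C1f sv cl lv).
have clin (a1 a2 : R) j : continuous (fun x => a1 * g j x + a2 * h j x).
  by apply: cD; apply: cM; (exact: cst_continuous || exact: cfun).
have cre j : continuous (fun x => complex.Re (lam * phi j x)).
  have := clin (complex.Re lam) (- complex.Im lam) j.
  have -> // : (fun x => complex.Re (lam * phi j x)) =
      fun x => complex.Re lam * g j x + - complex.Im lam * h j x.
  by apply/funext => x; rewrite complex_ReM mulNr.
have cim j : continuous (fun x => complex.Im (lam * phi j x)).
  have := clin (complex.Im lam) (complex.Re lam) j.
  have -> // : (fun x => complex.Im (lam * phi j x)) =
      fun x => complex.Im lam * g j x + complex.Re lam * h j x.
  by apply/funext => x; rewrite complex_ImM addrC.
have E : \int[vol]_x (\prod_(j < n) (complex.Re (phi j x) ^+ a j *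
      complex.Im (phi j x) ^+ b j)) =
    \int[vol]_x (\prod_(j < n) (complex.Im (phi j x) ^+ a j *
      (- complex.Re (phi j x)) ^+ b j)).
  apply: (@integral_rotate R X 'I_n (@C1_fun R m X) (fun f => continuous f)
    (metric G) (fun f => \int[vol]_x f x) _ _ _ _ _ _ _ _ _ _ _ _ _ _ _ _
    lam mu phi _ _ _ _ nondegenerate).
  - exact: C1_fun_cst.
  - exact: C1_funD.
  - exact: C1_funM.
  - exact: cfun.
  - exact: cD.
  - exact: cM.
  - exact: metric_continuous.
  - exact: metric_sym.
  - exact: metricDl.
  - exact: metricMl.
  - exact: metric_cstl.
  - exact: metric_ge0.
  - exact: metric_eq0.
  - move=> f k cf ck; apply: RintegralD => //; exact: intc.
  - move=> c f cf; apply: RintegralZl => //; exact: intc.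
  (* The real-valued integral is 0 also when the extended one is infinite, so integrability is used
     to recover the vanishing of the latter. *)
  - move=> f cf f0 intf; apply: (integral_eq0_continuous volG cf f0).
    by rewrite -[LHS]fineK ?[fine _]intf//; apply: integrable_fin_num => //; exact: intc.
  - by move=> j; split; [exact: C1g|exact: C1h].
  - move=> j w C1w; apply: (weak w (g j) _ C1w (sg j) (cre j)).
    move=> c ac x cx.
    exact: (congr1 (@complex.Re R) (lapE _ (phiF j) x c ac cx)).
  - move=> j w C1w; apply: (weak w (h j) _ C1w (sh j) (cim j)).
    move=> c ac x cx.
    exact: (congr1 (@complex.Im R) (lapE _ (phiF j) x c ac cx)).
  - move=> j k x.
    rewrite -(kapE _ _ (phiF j) (phiF k) x _ (chart_of_atlas x) (chart_of_dom x)).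
    exact/esym/(kappaE G (chart_of_atlas x) (chart_of_dom x)
      (C1g j) (C1h j) (C1g k) (C1h k)).
transitivity (\int[vol]_x ((-1) ^+ (\sum_(j < n) b j)%N *
    \prod_(j < n) (g j x ^+ b j * h j x ^+ a j))).
  rewrite [LHS]E; congr (Rintegral _ _ _); apply/funext => x.
  rewrite expr_sum -big_split /=; apply: eq_bigr => j _.
  by rewrite /= (exprNn (g j x)) mulrCA; congr (_ * _); exact: mulrC.
rewrite RintegralZl//; apply: intc.
have cX (f : X -> R) k : continuous f -> continuous (fun x => f x ^+ k).
  move=> cf x; apply: (@continuous_comp _ _ _ f (fun y : R => y ^+ k)).
    exact: cf.
  exact: exprn_continuous.
apply: (@continuous_big _ _ _ _ _ mul_continuous) => j _.
by apply: (cM _ _ (cX _ _ _) (cX _ _ _)); exact: cfun.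
Qed.
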